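(* Let $\Omega\subset\mathbb{R}^d$ be open and $T>0$. Let $O\subset\subset O'\subset\subset\Omega$ be open sets, $J\subset(0,T)$ an open interval, and $\ell_0>0$ with $\ell_0<\operatorname{dist}(O,\partial O')$. Let $u\in L^3(O'\times J;\mathbb{R}^d)$ be any vector field, let $\bullet\in\{\mathrm{DR},\mathrm{CET}\}$ be fixed, and let $T^\ell_\bullet$ and $D^\ell_\bullet=T^\ell_\bullet[u(t),u(t),u(t)]$ be the trilinear operator and the energy-flux approximation defined in the context. Let $X_1,X_2,X_3$ be three Banach spaces of $\mathbb{R}^d$-valued functions on $O'$ with $C^\infty(\overline{O'};\mathbb{R}^d)\subset X_i\subset L^1(O';\mathbb{R}^d)$ for $i=1,2,3$, and assume that there is a constant $C>0$ such that (in particular, $T^\ell_\bullet$ is well defined on $X_1\times X_2\times X_3$ with values in $L^1(O)$) $$\sup_{0<\ell<\ell_0}\|T^\ell_\bullet[v_1,v_2,v_3]\|_{L^1(O)}\le C\prod_{i=1}^3\|v_i\|_{X_i}\qquad\forall v_i\in X_i,\ i=1,2,3.$$ Assume moreover that $$\lim_{\ell\to0}\|T^\ell_\bullet[v_1,v_2,v_3]\|_{L^1(O)}=0$$ whenever $v_i\in X_i$ for $i=1,2,3$ and there exists an index $i_0\in\{1,2,3\}$ such that $v_{i_0}\in C^\infty(\overline{O'};\mathbb{R}^d)$. Let $p_1,p_2,p_3\in[1,\infty]$ with $\frac1{p_1}+\frac1{p_2}+\frac1{p_3}=1$. If $u\in L^{p_1}(J;X_1)\cap L^{p_2}(J;X_2)\cap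 L^{p_3}(J;X_3)$ and $C^\infty(\overline{O'};\mathbb{R}^d)$ is dense in at least one of the spaces $X_1,X_2,X_3$, then $D^\ell_\bullet\to0$ in $L^1(O\times J)$ as $\ell\to0$.
   Context: Let $\rho\in C^\infty_c(\mathbb{R}^d)$ be a fixed even mollification kernel supported in the unit ball with $\int\rho=1$, $\rho_\ell(x)=\ell^{-d}\rho(x/\ell)$, and let $v_\ell=v*\rho_\ell$ denote mollification in the space variable only. Write $\delta_{h}v(x):=v(x+h)-v(x)$ and $u(t):=u(\cdot,t)$. For $x\in O$ and $0<\ell<\ell_0$ define $$T^\ell_{\mathrm{DR}}[v_1,v_2,v_3](x):=\int_{\mathbb{R}^d}\nabla\rho(z)\cdot\frac{\delta_{\ell z}v_1(x)}{4\ell}\;\big(\delta_{\ell z}v_2(x)\cdot\delta_{\ell z}v_3(x)\big)\,dz,$$ $$T^\ell_{\mathrm{CET}}[v_1,v_2,v_3]:=\big((v_1)_\ell\otimes(v_2)_\ell-(v_1\otimes v_2)_\ell\big):\nabla(v_3)_\ell .$$ *)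

(* Defs.v *)
From HB Require Import structures.
From mathcomp Require Import all_boot all_order all_algebra.
From mathcomp Require Import all_classical all_reals all_analysis.

Set Implicit Arguments.
Unset Strict Implicit.
Unset Printing Implicit Defensive.

Import Order.TTheory GRing.Theory Num.Def Num.Theory.
Import numFieldNormedType.Exports.

Local Open Scope classical_set_scope.
Local Open Scope ring_scope.

Section measurable_rV.
Context {d : measure_display} {T : sigmaRingType d} (n : nat).

Let coords : 'I_n -> 'rV[T]_n -> T := fun i x => x ord0 i.

Let rV_set0 : g_sigma_preimage coords set0.
Proof. exact: sigma_algebra0. Qed.

Let rV_setC A : g_sigma_preimage coords A -> g_sigma_preimage coords (~` A).
Proof. exact: sigma_algebraC. Qed.

Let rV_bigcup (F : _^nat) : (forall i, g_sigma_preimage coords (F i)) ->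
  g_sigma_preimage coords (\bigcup_i (F i)).
Proof. exact: sigma_algebra_bigcup. Qed.

(* The sigma-algebra generated by the coordinates, as the library does for
   [n.-tuple T]; over the Borel sets of R it is the Borel sigma-algebra. *)
HB.instance Definition _ := @isMeasurable.Build (measure_tuple_display d)
  'rV[T]_n (g_sigma_preimage coords) rV_set0 rV_setC rV_bigcup.

End measurable_rV.

Section measurable_fun_rV.
Context d1 d2 (T1 : measurableType d1) (T2 : measurableType d2).

Lemma measurable_coord n (i : 'I_n) :
  measurable_fun [set: 'rV[T2]_n] (fun x : 'rV[T2]_n => x ord0 i).
Proof.
move=> _ Y mY; rewrite setTI; apply: sub_sigma_algebra => /=.
rewrite -bigcup_seq/=; exists i => /=; first by rewrite mem_index_enum.
by exists Y => //; rewrite setTI.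
Qed.

Lemma measurable_fun_rVP n (f : T1 -> 'rV[T2]_n) :
  measurable_fun [set: T1] f <->
  (forall i, measurable_fun [set: T1] (fun x => f x ord0 i)).
Proof.
split=> [mf i|mf].
  exact: (measurableT_comp (measurable_coord i) mf).
apply: (measurability (\big[setU/set0]_(i < n) preimage_set_system setT
  (fun x : 'rV[T2]_n => x ord0 i) measurable)) => //.
move=> _ [A + <-]; rewrite -bigcup_seq/= => -[i _ [B mB <-]].
by have := mf i measurableT _ mB; rewrite !setTI.
Qed.

End measurable_fun_rV.

Section rV_cons.
Context {R : realType} (n : nat).

Definition rV_cons (z : measurableTypeR R * 'rV[R]_n) : 'rV[R]_n.+1 :=
  \row_i (if unlift ord0 i is Some j then z.2 ord0 j else z.1).

Definition rV_uncons (x : 'rV[R]_n.+1) : measurableTypeR R * 'rV[R]_n :=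
  (x ord0 ord0, \row_j x ord0 (lift ord0 j)).

Lemma rV_consK : cancel rV_cons rV_uncons.
Proof.
move=> [a x]; rewrite /rV_uncons mxE unlift_none; congr pair.
by apply/rowP => j; rewrite !mxE liftK.
Qed.

Lemma rV_unconsK : cancel rV_uncons rV_cons.
Proof.
move=> x; apply/rowP => i; rewrite mxE.
by case: unliftP => [j ->|->]//=; rewrite mxE.
Qed.

Lemma measurable_rV_cons : measurable_fun setT rV_cons.
Proof.
apply/measurable_fun_rVP => i; under eq_fun do rewrite mxE.
case: (unlift ord0 i) => [j|]; last exact: measurable_fst.
exact: (measurableT_comp (measurable_coord j) measurable_snd).
Qed.

Lemma measurable_rV_uncons : measurable_fun setT rV_uncons.
Proof.
apply: measurable_fun_pair; first exact: measurable_coord.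
apply/measurable_fun_rVP => j; under eq_fun do rewrite mxE.
exact: measurable_coord.
Qed.

End rV_cons.

Section lebesgue_rV_step.
Context {R : realType} (n : nat).
Variable mu : {sigma_finite_measure set 'rV[R]_n -> \bar R}.

Definition lebesgue_rV_step : set 'rV[R]_n.+1 -> \bar R :=
  pushforward (@lebesgue_measure R \x mu)%E (@rV_cons R n).

HB.instance Definition _ := Measure.copy lebesgue_rV_step
  (measure_function_pushforward__canonical__measure_function_Measure
     (lebesgue_measure \x mu)%E (@measurable_rV_cons R n)).

Let lebesgue_rV_step_sigma_finite : sigma_finite setT lebesgue_rV_step.
Proof.
have /sigma_finiteP[F [TF ndF Foo]] := sigma_finiteT (@lebesgue_measure R).
have /sigma_finiteP[G [TG ndG Goo]] := sigma_finiteT mu.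
exists (fun i => @rV_uncons R n @^-1` (F i `*` G i)).
  rewrite -preimage_bigcup (_ : \bigcup_i _ = setT) ?preimage_setT//.
  rewrite -setXTT TF TG predeqE => -[x y]; split=> [[i _ []/= ? ?]|].
    by split; exists i.
  move=> [/= [i _ Fx] [j _ Gy]]; exists (maxn i j) => //; split.
  - by move: x Fx; exact/subsetPset/ndF/leq_maxl.
  - by move: y Gy; exact/subsetPset/ndG/leq_maxr.
move=> i; have [mF Fi] := Foo i; have [mG Gi] := Goo i; split.
  rewrite -[X in measurable X]setTI; apply: measurable_rV_uncons => //.
  exact: measurableX.
rewrite /lebesgue_rV_step /pushforward -comp_preimage.
rewrite (_ : @rV_uncons R n \o @rV_cons R n = id); last exact/funext/rV_consK.
rewrite preimage_id.
by rewrite product_measure1E// lte_mul_pinfty// ge0_fin_numE.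
Qed.

HB.instance Definition _ := Measure_isSigmaFinite.Build _ _ _
  lebesgue_rV_step lebesgue_rV_step_sigma_finite.

End lebesgue_rV_step.

Fixpoint lebesgue_rV (R : realType) (n : nat) :
    {sigma_finite_measure set 'rV[R]_n -> \bar R} :=
  match n with
  | 0 => [the {sigma_finite_measure set 'rV[R]_0 -> \bar R} of
            dirac (0 : 'rV[R]_0)]
  | m.+1 => [the {sigma_finite_measure set 'rV[R]_m.+1 -> \bar R} of
            lebesgue_rV_step (lebesgue_rV R m)]
  end.

Lemma lebesgue_rV_box {R : realType} n (A : 'I_n -> set R) :
  (forall i, measurable (A i)) ->
  lebesgue_rV R n [set x : 'rV[R]_n | forall i, A i (x ord0 i)] =
  (\prod_(i < n) lebesgue_measure (A i))%E.
Proof.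
elim: n A => [|n IH] A mA.
  rewrite big_ord0 /= diracE mem_set//= => -[]//.
rewrite big_ord_recl -(IH (fun i => A (lift ord0 i)))//=.
set B := [set x : 'rV[R]_n | _].
have mB : measurable B.
  rewrite (_ : B = \bigcap_(i in [set: 'I_n])
    ((fun x : 'rV[R]_n => x ord0 i) @^-1` A (lift ord0 i))); last first.
    by apply/seteqP; split=> x /= h i; [move=> _|]; exact: h.
  apply: fin_bigcap_measurable => // i _; rewrite -[X in measurable X]setTI.
  exact: measurable_coord.
rewrite -(product_measure1E lebesgue_measure (lebesgue_rV R n) (mA ord0) mB).
rewrite /lebesgue_rV_step /pushforward; congr product_measure1.
apply/seteqP; split=> -[a x] /=.
  move=> h; split; first by have := h ord0; rewrite mxE unlift_none.
  by move=> i; have := h (lift ord0 i); rewrite mxE liftK.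
move=> [Aa Ax] i; rewrite mxE; case: unliftP => [j ->|->]//.
Qed.

Section euclidean.
Context {R : realType} {d : nat}.
Implicit Types (x y : 'rV[R]_d) (A B : set 'rV[R]_d).

Definition dot x y : R := \sum_(i < d) x ord0 i * y ord0 i.

(* The canonical norm of ['rV[R]_d] is the sup norm, hence this one. *)
Definition enorm x : R := Num.sqrt (dot x x).

(* +oo when one of the sets is empty *)
Definition set_dist A B : \bar R :=
  ereal_inf [set (enorm (x - y))%:E | x in A & y in B].

Definition boundary A : set 'rV[R]_d := closure A `\` interior A.

Definition compactly_contained A B : Prop :=
  compact (closure A) /\ closure A `<=` B.

End euclidean.

Section calculus.
Context {R : realType} {d : nat}.

Definition partial {W : normedModType R} (i : 'I_d) (f : 'rV[R]_d -> W)
    (x : 'rV[R]_d) : W :=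
  'D_(delta_mx ord0 i) f x.

Definition iter_partial {W : normedModType R} (s : seq 'I_d)
    (f : 'rV[R]_d -> W) : 'rV[R]_d -> W :=
  foldr partial f s.

Definition grad (f : 'rV[R]_d -> R) (x : 'rV[R]_d) : 'rV[R]_d :=
  \row_i partial i f x.

(* (grad v)_ij = d_j v_i *)
Definition vgrad (v : 'rV[R]_d -> 'rV[R]_d) (x : 'rV[R]_d) : 'M[R]_d :=
  \matrix_(i, j) partial j (fun y => v y ord0 i) x.

(* C^oo(U), for U open; the values of f off U are irrelevant *)
Definition smooth_on {W : normedModType R} (U : set 'rV[R]_d)
    (f : 'rV[R]_d -> W) : Prop :=
  forall (s : seq 'I_d) (x : 'rV[R]_d), U x ->
    {for x, continuous (iter_partial s f)} /\
    forall i, derivable (iter_partial s f) x (delta_mx ord0 i).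

(* C^oo(closure U): smooth in U, every partial derivative of every order having
   a continuous extension to the closure of U *)
Definition smooth_closure {W : normedModType R} (U : set 'rV[R]_d)
    (f : 'rV[R]_d -> W) : Prop :=
  smooth_on U f /\
  forall s : seq 'I_d, exists2 g : 'rV[R]_d -> W,
    {within closure U, continuous g} &
    forall x, U x -> g x = iter_partial s f x.

Definition mollification_kernel (rho : 'rV[R]_d -> R) : Prop :=
  [/\ smooth_on setT rho,
      closure [set z | rho z != 0] `<=` [set z | enorm z <= 1],
      (forall z, rho (- z) = rho z) &
      \int[lebesgue_rV R d]_z rho z = 1].

Definition rescale (rho : 'rV[R]_d -> R) (l : R) (x : 'rV[R]_d) : R :=
  l ^- d * rho (l^-1 *: x).

(* Entrywise convolution f * rho_l; for f only given on an open set U it is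
   meaningful at the points at distance more than l from the complement of U,
   where the values of f off U are multiplied by 0. *)
Definition mollify (rho : 'rV[R]_d -> R) (l : R) {m n : nat}
    (f : 'rV[R]_d -> 'M[R]_(m, n)) (x : 'rV[R]_d) : 'M[R]_(m, n) :=
  \matrix_(i, j) \int[lebesgue_rV R d]_y (rescale rho l y * f (x - y) i j).

Definition mollifiable_at (rho : 'rV[R]_d -> R) (l : R) {m n : nat}
    (f : 'rV[R]_d -> 'M[R]_(m, n)) (x : 'rV[R]_d) : Prop :=
  forall i j, (lebesgue_rV R d).-integrable setT
    (fun y => (rescale rho l y * f (x - y) i j)%:E).

Definition increment (h : 'rV[R]_d) (v : 'rV[R]_d -> 'rV[R]_d)
    (x : 'rV[R]_d) : 'rV[R]_d :=
  v (x + h) - v x.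

Definition tensor (v w : 'rV[R]_d -> 'rV[R]_d) (x : 'rV[R]_d) : 'M[R]_d :=
  (v x)^T *m w x.

Definition frobenius (A B : 'M[R]_d) : R := \sum_i \sum_j A i j * B i j.

End calculus.

Section flux.
Context {R : realType} {d : nat}.
Implicit Types (rho : 'rV[R]_d -> R) (v : 'rV[R]_d -> 'rV[R]_d).

Inductive flux_kind := DR | CET.

Definition DR_integrand rho (l : R) v1 v2 v3 (x z : 'rV[R]_d) : R :=
  dot (grad rho z) ((4 * l)^-1 *: increment (l *: z) v1 x) *
  dot (increment (l *: z) v2 x) (increment (l *: z) v3 x).

Definition DR_flux rho (l : R) v1 v2 v3 (x : 'rV[R]_d) : R :=
  \int[lebesgue_rV R d]_z DR_integrand rho l v1 v2 v3 x z.

Definition CET_flux rho (l : R) v1 v2 v3 (x : 'rV[R]_d) : R :=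
  frobenius
    (tensor (mollify rho l v1) (mollify rho l v2) x -
     mollify rho l (tensor v1 v2) x)
    (vgrad (mollify rho l v3) x).

Definition flux (k : flux_kind) rho (l : R) v1 v2 v3 : 'rV[R]_d -> R :=
  match k with
  | DR => DR_flux rho l v1 v2 v3
  | CET => CET_flux rho l v1 v2 v3
  end.

(* The integrals in the definition of [flux] converge absolutely at x; since
   integration is a total operation, this has to be required separately. The
   mollified fields in [CET_flux] are not mentioned because they always make
   sense for locally integrable fields. *)
Definition flux_defined_at (k : flux_kind) rho (l : R) v1 v2 v3
    (x : 'rV[R]_d) : Prop :=
  match k with
  | DR => (lebesgue_rV R d).-integrable setT
            (fun z => (DR_integrand rho l v1 v2 v3 x z)%:E)
  | CET => mollifiable_at rho l (tensor v1 v2) x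
  end.

End flux.

Section Lebesgue_spaces.
Context {disp : measure_display} {T : measurableType disp} {R : realType}.
Variable mu : {measure set T -> \bar R}.

Definition Lnorm_on (p : \bar R) (D : set T) (f : T -> R) : \bar R :=
  'N[mu]_p[(EFin \o f) \_ D].

(* f is a.e. equal on D to an integrable function; the library's notion of
   integrability is not invariant under modification on null sets because the
   sigma-algebra is not complete. *)
Definition in_L1 (D : set T) (f : T -> R) : Prop :=
  exists2 g : T -> R, mu.-integrable D (EFin \o g) &
    {ae mu, forall x, D x -> f x = g x}.

Definition in_Lp_vec {d : nat} (p : \bar R) (D : set T) (f : T -> 'rV[R]_d) :
    Prop :=
  measurable_fun D f /\ (Lnorm_on p D (fun x => enorm (f x)) < +oo)%E.

Definition simple_on {X : Type} (D : set T) (s : T -> X) : Prop :=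
  finite_set (s @` D) /\
  forall a, measurable (D `&` s @^-1` [set a]).

Definition strongly_measurable {X : topologicalType} (D : set T) (f : T -> X) :
    Prop :=
  exists2 s : nat -> T -> X, (forall n, simple_on D (s n)) &
    forall t, D t -> s n t @[n --> \oo] --> f t.

Definition in_Lp_Bochner {X : normedModType R} (p : \bar R) (D : set T)
    (f : T -> X) : Prop :=
  strongly_measurable D f /\ (Lnorm_on p D (fun t => `|f t|%R) < +oo)%E.

End Lebesgue_spaces.

(* A Banach space X of (classes modulo equality a.e. of) fields on U with
   C^oo(closure U) included in X and X included in L^1(U): an abstract Banach
   space together with a choice, for each of its elements, of a representative,
   this representation being linear and injective modulo equality a.e. on U. *)
Record banach_field_space (R : realType) (d : nat) (U : set 'rV[R]_d) :=
  BanachFieldSpace {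
  carrier :> completeNormedModType R;
  field_of : carrier -> 'rV[R]_d -> 'rV[R]_d;
  field_of_linear : forall (a : R) (v w : carrier),
    {ae lebesgue_rV R d, forall x, U x ->
      field_of (a *: v + w) x = a *: field_of v x + field_of w x};
  field_of_inj : forall v : carrier,
    {ae lebesgue_rV R d, forall x, U x -> field_of v x = 0} -> v = 0;
  field_of_L1 : forall v : carrier,
    in_Lp_vec (lebesgue_rV R d) 1%E U (field_of v);
  smooth_in_space : forall phi : 'rV[R]_d -> 'rV[R]_d, smooth_closure U phi ->
    exists v : carrier,
      {ae lebesgue_rV R d, forall x, U x -> field_of v x = phi x}
}.

Section field_spaces.
Context {R : realType} {d : nat} {U : set 'rV[R]_d}.

Definition smooth_elements (X : banach_field_space U) : set X :=
  [set v : X | exists2 phi : 'rV[R]_d -> 'rV[R]_d, smooth_closure U phi &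
    {ae lebesgue_rV R d, forall x, U x -> field_of v x = phi x}].

(* u, as t |-> u(., t), is in L^p(J; X) *)
Definition in_Lp_field (X : banach_field_space U) (p : \bar R) (J : set R)
    (u : 'rV[R]_d * measurableTypeR R -> 'rV[R]_d) : Prop :=
  exists2 f : R -> X, in_Lp_Bochner lebesgue_measure p J f &
    {ae lebesgue_measure, forall t, J t ->
      {ae lebesgue_rV R d, forall x, U x -> field_of (f t) x = u (x, t)}}.

End field_spaces.
Arguments smooth_elements {R d U} X.

Section flux_on_spaces.
Context {R : realType} {d : nat} {U : set 'rV[R]_d}.
Variables (k : flux_kind) (rho : 'rV[R]_d -> R).
Variable X : 'I_3 -> banach_field_space U.

Definition space_flux (l : R) (v : forall i, X i) : 'rV[R]_d -> R :=
  flux k rho l (field_of (v 0)) (field_of (v 1)) (field_of (v 2)).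

(* The operator of parameter l is well defined on X_1 x X_2 x X_3 with values
   in L^1(O). *)
Definition space_flux_defined (O : set 'rV[R]_d) (l : R) : Prop :=
  forall v : (forall i, X i),
    {ae lebesgue_rV R d, forall x, O x ->
      flux_defined_at k rho l
        (field_of (v 0)) (field_of (v 1)) (field_of (v 2)) x} /\
    in_L1 (lebesgue_rV R d) O (space_flux l v).

End flux_on_spaces.

(* [lebesgue_measure] lives on [measurableTypeR R], which is R with its Borel
   sets. *)
Definition spacetime_measure (R : realType) (d : nat) :
    {measure set ('rV[R]_d * measurableTypeR R) -> \bar R} :=
  [the {measure set ('rV[R]_d * measurableTypeR R) -> \bar R} of
    (lebesgue_rV R d \x @lebesgue_measure R)%E].

(* Main.v *)
(* For a fixed triple (v_1, v_2, v_3) the flux tends to 0 in L^1(O): in the slot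
   where smooth fields are dense, write v_i = a + b with a smooth and b small;
   the flux is additive in that slot, its a-part tends to 0 by hypothesis and
   its b-part is small by the trilinear bound. Apply this to the three
   representatives of u(t), for almost every t. The L^1(O) norms so obtained are
   dominated by C prod_i |u(t)|_{X_i}, which is integrable on J by Hoelder, so
   that Tonelli and dominated convergence in t conclude.

   At a point of O only the values of the fields on O' matter, so fields are
   replaced by their extensions by zero. For these, additivity, invariance under
   modification on null sets and joint measurability in (x, t) are statements on
   integrals over the whole space; in the CET case the gradient of a mollified
   field must first be moved onto the kernel, since ['D_v] is additive only on
   derivable functions. *)
Require Import Defs.
From HB Require Import structures.
From mathcomp Require Import all_boot all_order all_algebra.
From mathcomp Require Import all_classical all_reals all_analysis.
From mathcomp Require Import measurable_realfun ess_sup_inf ring lra.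

Set Implicit Arguments.
Unset Strict Implicit.
Unset Printing Implicit Defensive.

Import Order.TTheory GRing.Theory Num.Def Num.Theory.
Import numFieldNormedType.Exports.

Local Open Scope classical_set_scope.
Local Open Scope ring_scope.

(** * Affine changes of variables and measurability on row vectors *)

Section affine_invariance.
Context {R : realType}.

(** Lebesgue measure is determined by its values on half-open intervals, so comparing there
    suffices. The sign of c is split because a negative c exchanges the open and closed ends of the
    preimage. *)
Lemma lebesgue_measure_affine (a c : R) (A : set R) : c != 0 -> measurable A ->
  lebesgue_measure A =
  (`|c|%:E * lebesgue_measure ((fun x : R => a + c * x)%R @^-1` A))%E.
Proof.
move=> c0 mA.
have mf : measurable_fun setT
    (fun x : measurableTypeR R => a + c * x : measurableTypeR R).
  by apply: measurable_funD => //; exact: measurable_funM.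
pose mu := mscale (NngNum (normr_ge0 c))
  (measure_function_pushforward__canonical__measure_function_Measure
     (@lebesgue_measure R) mf).
apply: (@lebesgue_measure_unique R mu) => // _ [[x y] _ <-] /=.
rewrite /mu /mscale /= /pushforward.
rewrite lebesgue_measure_itv /=.
have [c_gt0|c_lt0|c_eq0] := ltgtP 0 c; last by rewrite -c_eq0 eqxx in c0.
- rewrite [X in lebesgue_measure X](_ : _ =
      `](x - a) / c, (y - a) / c]%classic); last first.
    apply/seteqP; split => z /=; rewrite !in_itv/= ltr_pdivrMr// ler_pdivlMr//;
    by rewrite ltrBlDl lerBrDl (mulrC z).
  rewrite lebesgue_measure_itv /= !lte_fin ltr_pM2r ?invr_gt0// ltrD2r.
  case: ifPn => _; last by rewrite mule0.
  rewrite -!EFinB -EFinM; congr EFin.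
  by rewrite gtr0_norm//; field.
- rewrite [X in lebesgue_measure X](_ : _ =
      `[(y - a) / c, (x - a) / c[%classic); last first.
    apply/seteqP; split => z /=; rewrite !in_itv/= ler_ndivrMr// ltr_ndivlMr//;
    by rewrite ltrBlDl lerBrDl (mulrC z) andbC.
  rewrite lebesgue_measure_itv /= !lte_fin ltr_nM2r ?invr_lt0// ltrD2r.
  case: ifPn => _; last by rewrite mule0.
  rewrite -!EFinB -EFinM; congr EFin.
  by rewrite ltr0_norm//; field.
Qed.

End affine_invariance.

Section affine_rV.
Context {R : realType}.

Lemma measurable_rV_box d (F : 'I_d -> set R) :
  (forall i, measurable (F i)) ->
  measurable [set x : 'rV[R]_d | forall i, F i (x ord0 i)].
Proof.
move=> mF; have -> : [set x : 'rV[R]_d | forall i, F i (x ord0 i)] =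
    \bigcap_(i in [set: 'I_d]) ((fun x : 'rV[R]_d => x ord0 i) @^-1` F i).
  by apply/seteqP; split=> x /= h i; [move=> _|]; exact: h.
apply: fin_bigcap_measurable => // i _; rewrite -[X in measurable X]setTI.
exact: (measurable_coord _ _ (mF i)).
Qed.

(** Both sides are measures in A. They agree on boxes, where each coordinate contributes one factor
    [|c|]; boxes are stable under intersection, generate the sigma-algebra, and contain an
    exhaustion by boxes of finite measure. *)
Lemma lebesgue_rV_affine d (a : 'rV[R]_d) (c : R) (A : set 'rV[R]_d) :
  c != 0 -> measurable A ->
  lebesgue_rV R d A =
  ((`|c| ^+ d)%:E * lebesgue_rV R d ((fun x => a + c *: x)%R @^-1` A))%E.
Proof.
move=> c0 mA.
have mf : measurable_fun setT (fun x : 'rV[R]_d => a + c *: x).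
  apply/measurable_fun_rVP => i; under eq_fun do rewrite !mxE.
  apply: measurable_funD => //; apply: measurable_funM => //.
  exact: measurable_coord.
pose mu := mscale (NngNum (exprn_ge0 d (normr_ge0 c)))
  (measure_function_pushforward__canonical__measure_function_Measure
     (lebesgue_rV R d) mf).
pose G := [set B : set 'rV[R]_d | exists2 F : 'I_d -> set R,
  (forall i, measurable (F i)) & B = [set x | forall i, F i (x ord0 i)]].
pose I (n : nat) : set R := `](- n%:R), n%:R]%classic.
pose g (n : nat) := [set x : 'rV[R]_d | forall i, I n (x ord0 i)].
rewrite (_ : (_ * _)%E = mu A)//.
apply: (measure_unique G g) => //.
- apply/seteqP; split => B.
    move=> mB; apply: (sub_sigma_algebra2 _ mB) => {B mB} B.
    rewrite -bigcup_seq/= => -[i _ [Y mY <-]].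
    exists (fun j => if j == i then Y else setT); first by move=> j; case: ifP.
    apply/seteqP; split => x /=.
      by move=> [_ Yx] j; case: ifP => // /eqP ->.
    by move=> h; split => //; have := h i; rewrite eqxx.
  apply: (smallest_sub (sigma_algebra_measurable _)) => _ [F mF ->].
  exact: measurable_rV_box.
- move=> _ _ [F mF ->] [F' mF' ->]; exists (fun i => F i `&` F' i).
    by move=> i; exact: measurableI.
  apply/seteqP; split => x /=.
    by move=> [h h'] i; split.
  by move=> h; split => i; have [] := h i.
- by move=> n; exists (fun=> I n) => // _; exact: measurable_itv.
- apply/seteqP; split => // x _.
  (* The sum dominates every coordinate, so one integer serves for all of them. *)
  exists (truncn (\sum_i `|x ord0 i|)).+1 => // i /=.
  have : `|x ord0 i| < (truncn (\sum_i `|x ord0 i|)).+1%:R.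
    apply: le_lt_trans (truncnS_gt _).
    rewrite (bigD1 i)//= lerDl; apply: sumr_ge0 => //.
  by rewrite ltr_norml /I/= in_itv/= => /andP[-> /ltW].
- move=> _ [F mF ->].
  transitivity (\prod_(i < d) lebesgue_measure (F i))%E.
    exact: lebesgue_rV_box.
  pose F' i := (fun y : R => a ord0 i + c * y)%R @^-1` F i.
  transitivity ((`|c| ^+ d)%:E *
      lebesgue_rV R d [set x : 'rV[R]_d | forall i, F' i (x ord0 i)])%E;
          last first.
    rewrite /mu /mscale /= /pushforward; congr (_ * lebesgue_rV R d _)%E.
    by apply/seteqP; split => x /= h i; have := h i; rewrite !mxE.
  rewrite lebesgue_rV_box; last first.
    move=> i; rewrite -[X in measurable X]setTI.
    by apply: (measurable_funD _ (measurable_funM _ _)) => //.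
  rewrite (eq_bigr (fun i => `|c|%:E * lebesgue_measure (F' i)))%E; last first.
    by move=> i _; exact: lebesgue_measure_affine.
  by rewrite big_split/= prodEFin prodr_const card_ord.
- move=> n; rewrite [X in (X < _)%E](lebesgue_rV_box (fun=> measurable_itv _)).
  have -> : (\prod_(i < d) lebesgue_measure (I n) =
      (\prod_(i < d) (if - n%:R < n%:R :> R then n%:R - - n%:R else 0))%:E :>
          \bar R)%E.
    rewrite -prodEFin; apply: eq_bigr => i _.
    by rewrite /I lebesgue_measure_itv/= lte_fin; case: ifP.
  exact: ltry.
Qed.

End affine_rV.

Section measurability_rV.
Context {R : realType}.

(** The sigma-algebra is generated by coordinates, not by the topology. The link is that sup-norm
    balls are boxes, and an open set is the union of the countably many boxes with rational centre
    and radius 1/(n+1) that it contains. *)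
Lemma open_measurable_rV d (A : set 'rV[R]_d) : open A -> measurable A.
Proof.
move=> oA.
pose B (q : 'rV[rat]_d * nat) := [set x : 'rV[R]_d |
  forall i, (ball (ratr (q.1 ord0 i) : R) q.2.+1%:R^-1 : set R) (x ord0 i)].
have -> : A = \bigcup_(q in [set: 'rV[rat]_d * nat])
    (if pselect (B q `<=` A) then B q else set0).
  apply/seteqP; split => x.
    move=> Ax; have : nbhs x A by exact: open_nbhs_nbhs.
    move=> /nbhs_ballP[e /= e0 xeA].
    (* With 1/(n+1) < e/2, a box of that radius whose centre is within 1/(n+1) of x stays in the
       ball of radius e around x. *)
    pose n := truncn (2 / e).
    have ne : n.+1%:R^-1 < e / 2.
      rewrite invf_plt ?posrE ?divr_gt0// invf_div.
      exact: truncnS_gt.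
    have /choice[q qx] i : exists q : rat,
        ball (ratr q : R) n.+1%:R^-1 (x ord0 i).
      have [q] := @rat_in_itvoo R
         (x ord0 i - n.+1%:R^-1) (x ord0 i + n.+1%:R^-1)
         ltac:(by rewrite ltrD2l gtrN ?invr_gt0).
      rewrite in_itv/= => /andP[q1 q2]; exists q.
      rewrite /ball/= ltr_norml; set r := _^-1 in q1 q2 *.
      by apply/andP; split; lra.
    exists (\row_i q i, n) => //.
    case: pselect => [?|nA]; first by move=> i; rewrite /= mxE.
    exfalso; apply: nA => y /= yB; apply: xeA; split => // i j; rewrite !ord1.
    have := yB j; have := qx j; rewrite /ball/= mxE !ltr_norml.
    set r := n.+1%:R^-1 in ne *; move=> /andP[? ?] /andP[? ?].
    by apply/andP; split; lra.
  by move=> [q _]; case: pselect => // qA; exact: qA.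
apply: countable_bigcupT_measurable => [|q].
  exact: countableP.
case: pselect => ? /=; last by [].
exact: (measurable_rV_box (fun i => measurable_ball _ _)).
Qed.

Lemma continuous_measurable_rV d (f : 'rV[R]_d -> R) :
  continuous f -> measurable_fun setT f.
Proof.
move=> /continuousP cf.
apply: (measurability _ (RGenOInfty.measurableE R)) => //.
move=> /= _ [_ [a ->] <-]; rewrite setTI; apply: open_measurable_rV.
exact/cf/rray_open.
Qed.

Import HBNNSimple.

(** No measurability of f or g is assumed: the integral is a supremum over simple functions, and a
    simple function below f, set to 0 on the exceptional null set, keeps its integral and lies below
    g. This matters because fluxes of arbitrary representatives are not known to be measurable. *)
Lemma ge0_ae_le_integral {disp} {T : measurableType disp}
    (mu : {measure set T -> \bar R}) (f g : T -> \bar R) :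
  (forall x, 0 <= f x)%E -> (forall x, 0 <= g x)%E ->
  {ae mu, forall x, f x <= g x}%E ->
  (\int[mu]_x f x <= \int[mu]_x g x)%E.
Proof.
move=> f0 g0 [N [mN N0 Nfg]].
rewrite !ge0_integralTE//; apply: ge_ereal_sup => _ [h /= hf <-].
rewrite -integralT_nnsfun (ge0_negligible_integral mN)//; last 2 first.
  exact/measurable_EFinP/measurable_funPT.
  by move=> x _; rewrite lee_fin.
rewrite setTD integral_nnsfun; last exact: measurableC.
have mCN := measurableC mN.
rewrite (mrestrict h mCN).
apply: ereal_sup_ubound; exists (proj_nnsfun h mCN) => //= x.
rewrite mindicE; case: (boolP (x \in _)) => [|_]; last by rewrite mulr0.
rewrite inE mulr1 => Nx; apply: le_trans (hf x) _.
by apply: contrapT => fg; apply: Nx; apply: Nfg.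
Qed.

Lemma ge0_ae_eq_integral_nonmeas {disp} {T : measurableType disp}
    (mu : {measure set T -> \bar R}) (f g : T -> \bar R) :
  (forall x, 0 <= f x)%E -> (forall x, 0 <= g x)%E ->
  {ae mu, forall x, f x = g x} ->
  (\int[mu]_x f x = \int[mu]_x g x)%E.
Proof.
move=> f0 g0 fg; apply/eqP; rewrite eq_le; apply/andP; split;
  apply: ge0_ae_le_integral => //; apply: filterS fg => x ->; exact: lexx.
Qed.

(** The scaling formula makes the preimage of a null set null, its factor [|c| ^+ d] being
    nonzero. *)
Lemma ae_rV_affine d (a : 'rV[R]_d) (c : R) (P : set 'rV[R]_d) : c != 0 ->
  {ae lebesgue_rV R d, forall x, P x} ->
  {ae lebesgue_rV R d, forall x, P (a + c *: x)}.
Proof.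
move=> c0 [N [mN N0 NP]].
exists ((fun x => a + c *: x) @^-1` N); split.
- rewrite -[X in measurable X]setTI; apply: measurable_funTS => //.
  apply/measurable_fun_rVP => i; under eq_fun do rewrite !mxE.
  apply: measurable_funD => //; apply: measurable_funM => //.
  exact: measurable_coord.
- have := lebesgue_rV_affine a c0 mN; rewrite N0 => /esym/eqP.
  rewrite mule_eq0 => /orP[|/eqP//].
  by rewrite eqe expf_eq0 normr_eq0 (negbTE c0) andbF.
- by move=> x /= nP; apply: NP.
Qed.

End measurability_rV.

Section sub_rV.
Context {R : realType} (d : nat).
Local Notation mu := (lebesgue_rV R d).

Lemma measurable_fun_subrV (x : 'rV[R]_d) :
  measurable_fun setT (fun y : 'rV[R]_d => x - y).
Proof.
apply/measurable_fun_rVP => i; under eq_fun do rewrite !mxE.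
apply: measurable_funB => //; exact: measurable_coord.
Qed.

Lemma integral_rV_sub (x : 'rV[R]_d) (f : 'rV[R]_d -> \bar R) :
  measurable_fun setT f -> (forall y, 0 <= f y)%E ->
  (\int[mu]_y f (x - y)%R = \int[mu]_y f y)%E.
Proof.
move=> mf f0.
have /= := @ge0_integral_pushforward _ _ _ _ _ _ (measurable_fun_subrV x) mu
    setT f
  measurableT mf (fun y _ => f0 y).
rewrite preimage_setT => <-.
apply: eq_measure_integral => [|? A mA _]; first exact: measurable_fun_subrV.
have /= := @lebesgue_rV_affine R d x (-1) A; rewrite oppr_eq0 oner_eq0.
move=> /(_ isT mA) ->; rewrite normrN1 expr1n mul1e /pushforward.
by congr (mu _); apply/funext => y /=; rewrite scaleN1r.
Qed.

Lemma integrable_rV_sub (x : 'rV[R]_d) (f : 'rV[R]_d -> R) :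
  mu.-integrable setT (EFin \o f) ->
  mu.-integrable setT (fun y => (f (x - y))%:E).
Proof.
move=> /integrableP[mf fi]; apply/integrableP; split.
  exact: (measurableT_comp mf (measurable_fun_subrV x)).
rewrite (integral_rV_sub x (f := fun y => `|(f y)%:E|%E))//.
exact: measurableT_comp.
Qed.

(** Positive and negative parts are reflected separately, so measurability suffices even when the
    integral diverges. *)
Lemma Rintegral_rV_sub (x : 'rV[R]_d) (f : 'rV[R]_d -> R) :
  measurable_fun setT f ->
  \int[mu]_y f (x - y) = \int[mu]_y f y.
Proof.
move=> mf; rewrite /Rintegral; congr fine.
have mf' : measurable_fun setT (EFin \o f) by exact/measurable_EFinP.
rewrite integralE [RHS]integralE.
rewrite -(integral_rV_sub x (measurable_funepos mf'))//.
rewrite -[in RHS](integral_rV_sub x (measurable_funeneg mf'))//.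
congr (_ - _)%E; apply: eq_integral => y _; rewrite ?funeposE ?funenegE //=.
Qed.

End sub_rV.

(** * Convolutions and their derivatives *)

Section derive_along.
Context {R : realType}.

Lemma is_derive_cvg (V W : normedModType R) (f : V -> W) (a v : V) (df : W) :
  h^-1 *: (f (h *: v + a) - f a) @[h --> 0^'] --> df -> is_derive a v f df.
Proof.
move=> fdf; split; first by apply/cvg_ex; exists df.
exact: cvg_lim.
Qed.

(** Turns a directional derivative into one in a real variable, the form required for
    differentiation under the integral sign. *)
Lemma is_derive_line (V W : normedModType R) (f : V -> W) (p v : V)
    (t : R) (df : W) :
  is_derive (p + t *: v) v f df ->
  is_derive t 1 (fun s : R => f (p + s *: v)) df.
Proof.
move=> [fv <-]; apply: is_derive_cvg.
under eq_fun => h do rewrite scaler1 scalerDl addrCA.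
exact: fv.
Qed.

End derive_along.

Section convolution.
Context {R : realType} {d : nat}.
Local Notation mu := (lebesgue_rV R d).
Implicit Types (K dK f g : 'rV[R]_d -> R).

Definition convol K f (x : 'rV[R]_d) : R := \int[mu]_y (K y * f (x - y)).

Lemma integrable_bounded_mul {disp} {T : measurableType disp}
    (nu : {measure set T -> \bar R}) (k f : T -> R) (M : R) :
  measurable_fun setT k -> (forall y, `|k y| <= M) ->
  nu.-integrable setT (EFin \o f) ->
  nu.-integrable setT (fun y => (k y * f y)%:E).
Proof.
move=> mk kM intf.
apply: (@le_integrable _ _ _ nu _ measurableT _
  (fun y => M%:E * (EFin \o f) y)%E).
- apply/measurable_EFinP; apply: measurable_funM => //.
  by have /integrableP[/measurable_EFinP] := intf.
- move=> y _; rewrite -EFinM /= lee_fin !normrM ler_wpM2r//.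
  exact: le_trans (kM y) (ler_norm _).
- exact: integrableZl.
Qed.

Lemma measurable_addrV (p : 'rV[R]_d) (c : R) :
  measurable_fun setT (fun y : 'rV[R]_d => p + c *: y).
Proof.
apply/measurable_fun_rVP => i; under eq_fun do rewrite !mxE.
apply: measurable_funD => //; apply: measurable_funM => //.
exact: measurable_coord.
Qed.

Lemma integrable_convol K f (M : R) (x : 'rV[R]_d) : continuous K ->
  (forall y, `|K y| <= M) -> mu.-integrable setT (EFin \o f) ->
  mu.-integrable setT (fun y => (K y * f (x - y))%:E).
Proof.
move=> cK KM intf; apply: integrable_bounded_mul KM _.
  exact: continuous_measurable_rV.
exact: integrable_rV_sub.
Qed.

(** Puts x into the kernel, so that differentiating in x asks for no regularity of f. *)
Lemma convol_sub K f (x : 'rV[R]_d) : continuous K -> measurable_fun setT f ->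
  convol K f x = \int[mu]_y (f y * K (x - y)).
Proof.
move=> cK mf; rewrite -[RHS](Rintegral_rV_sub x).
  by rewrite /convol; apply: eq_Rintegral => y _; rewrite subKr mulrC.
apply: measurable_funM => //.
apply: measurableT_comp; first exact: continuous_measurable_rV.
exact: measurable_fun_subrV.
Qed.

(** Differentiation under the integral sign along the line t |-> x + t e, dominated by the
    integrable function dM |f|. The parameter interval ]-1, 1[ is an arbitrary neighbourhood of
    0. *)
Lemma is_derive_convol K dK f (M dM : R) (e x : 'rV[R]_d) :
  continuous K -> continuous dK ->
  (forall y, `|K y| <= M) -> (forall y, `|dK y| <= dM) ->
  (forall y, is_derive y e K (dK y)) ->
  mu.-integrable setT (EFin \o f) ->
  is_derive x e (convol K f) (convol dK f x).
Proof.
move=> cK cdK KM dKM derK intf.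
have mf : measurable_fun setT f by have /integrableP[/measurable_EFinP] := intf.
pose F (t : R) (y : 'rV[R]_d) := f y * K (x - y + t *: e).
have derF (t : R) (y : 'rV[R]_d) :
    is_derive t (1 : R) (F^~ y) (f y * dK (x - y + t *: e)).
  apply: is_deriveZ; apply: is_derive_line; exact: derK.
have cvF :=
  @cvg_differentiation_under_integral R _ _ mu F setT measurableT 0 (-1) 1.
apply: is_derive_cvg.
have -> : (fun h => h^-1 *: (convol K f (h *: e + x) - convol K f x)) =
    (fun h => h^-1 *: ((fun t => \int[mu]_(y in setT) F t y) (h + 0) -
      \int[mu]_(y in setT) F 0 y)).
  apply/funext => h; rewrite !convol_sub//; congr (_ *: (_ - _)).
    by apply: eq_Rintegral => y _; rewrite /F addr0 -addrA addrC.
  by apply: eq_Rintegral => y _; rewrite /F scale0r addr0.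
rewrite (convol_sub _ cdK mf).
rewrite (_ : \int[mu]_y (f y * dK (x - y)) =
    \int[mu]_(y in setT) partial1of2 F 0 y); last first.
  apply: eq_Rintegral => y _; rewrite partial1of2E.
  by have [_ ->] := derF 0 y; rewrite scale0r addr0.
apply: (cvF _ _ _ (fun y => dM * `|f y|)).
- by rewrite /= in_itv/= ltrN10 ltr01.
- move=> t _; rewrite (_ : _ \o _ = (fun y => (K (x - y + t *: e) * f y)%:E));
      last first.
    by apply/funext => y /=; rewrite /F mulrC.
  apply: integrable_bounded_mul (fun y => KM _) intf.
  apply: measurableT_comp; first exact: continuous_measurable_rV.
  under eq_fun => y do rewrite addrAC -scaleN1r.
  exact: measurable_addrV.
- by move=> t y _ _; have [] := derF t y.
- by move=> y; rewrite mulr_ge0// (le_trans _ (dKM 0)).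
- rewrite (_ : _ \o _ = (fun y => dM%:E * (abse \o (EFin \o f)) y)%E)//.
  by apply: integrableZl => //; exact: integrable_abse.
- move=> t y _ _; rewrite partial1of2E; have [_ ->] := derF t y.
  by rewrite normrM mulrC ler_wpM2r.
Qed.

(** Integrability is asked only of the two integrands at the given x: for products of components of
    fields nothing more is available. *)
Lemma convolD K f g h (x : 'rV[R]_d) : (forall y, f y = g y + h y) ->
  mu.-integrable setT (fun y => (K y * g (x - y))%:E) ->
  mu.-integrable setT (fun y => (K y * h (x - y))%:E) ->
  convol K f x = convol K g x + convol K h x.
Proof.
move=> fgh ig ih; rewrite /convol -RintegralD//.
by apply: eq_Rintegral => y _; rewrite fgh mulrDr.
Qed.

Lemma convol_ae_eq K f g (x : 'rV[R]_d) : continuous K ->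
  measurable_fun setT f -> measurable_fun setT g ->
  {ae mu, forall y, f y = g y} -> convol K f x = convol K g x.
Proof.
move=> cK mf mg fg; rewrite /convol /Rintegral; congr fine.
have mK := continuous_measurable_rV cK.
apply: ae_eq_integral => //.
- apply/measurable_EFinP; apply: measurable_funM => //.
  exact: (measurableT_comp mf (measurable_fun_subrV x)).
- apply/measurable_EFinP; apply: measurable_funM => //.
  exact: (measurableT_comp mg (measurable_fun_subrV x)).
- have := ae_rV_affine x (c := -1) _ fg; rewrite oppr_eq0 oner_eq0 => /(_ isT).
  by apply: filterS => y; rewrite scaleN1r => fy _; rewrite fy.
Qed.

End convolution.

Section enorm.
Context {R : realType} {d : nat}.
Implicit Types x y : 'rV[R]_d.

Lemma enormZ (c : R) x : enorm (c *: x) = `|c| * enorm x.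
Proof.
rewrite /enorm -sqrtr_sqr -sqrtrM ?sqr_ge0//; congr Num.sqrt.
rewrite /dot mulr_sumr; apply: eq_bigr => i _; rewrite !mxE.
by rewrite expr2 mulrACA.
Qed.

Lemma enormN x : enorm (- x) = enorm x.
Proof. by rewrite -scaleN1r enormZ normrN1 mul1r. Qed.

Lemma enorm_ge0 x : 0 <= enorm x.
Proof. exact: sqrtr_ge0. Qed.

Lemma coord_le_enorm x i : `|x ord0 i| <= enorm x.
Proof.
rewrite -sqrtr_sqr ler_wsqrtr// /dot (bigD1 i)//= expr2 lerDl.
by apply: sumr_ge0 => j _; rewrite -expr2 sqr_ge0.
Qed.

Lemma norm_le_enorm x : `|x| <= enorm x.
Proof.
rewrite [leLHS]/normr/= mx_normrE; apply/bigmax_leP; split.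
  exact: enorm_ge0.
by move=> [i j] _ /=; rewrite ord1 coord_le_enorm.
Qed.

(** The sup norm is at most the Euclidean norm, so f vanishes off the closed sup-norm unit ball,
    which is compact. *)
Lemma bounded_of_support (f : 'rV[R]_d -> R) : continuous f ->
  (forall z, f z != 0 -> enorm z <= 1) -> exists M, forall z, `|f z| <= M.
Proof.
move=> cf f1.
have cB : compact [set z : 'rV[R]_d | `|z| <= 1].
  apply: bounded_closed_compact.
    by exists 1; split => // M M1 z /= /le_trans; apply; exact: ltW.
  apply: (@preimage_closed 'rV[R]_d R (fun z => `|z|) [set r | r <= 1]).
    by move=> z _; exact: norm_continuous.
  exact: closed_le.
have /compact_bounded[M [_ fM]] : compact (f @` [set z : 'rV[R]_d | `|z| <= 1]).
  by apply: continuous_compact cB; exact: continuous_subspaceT.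
exists (`|M| + 1) => z; have [->|fz0] := eqVneq (f z) 0.
  by rewrite normr0 addr_ge0.
apply: fM; last by exists z => //=; rewrite (le_trans (norm_le_enorm _))// f1.
by rewrite (le_lt_trans (ler_norm _))// ltrDl.
Qed.

End enorm.

(** * The rescaled kernel and its partial derivatives *)

Section kernel.
Context {R : realType} {d : nat}.
Variables (rho : 'rV[R]_d -> R) (l : R).
Hypotheses (hrho : mollification_kernel rho) (l_gt0 : 0 < l).
Implicit Types (x y z : 'rV[R]_d) (i : 'I_d).

Let l_ge0 : 0 <= l. Proof. exact: ltW. Qed.

Let rho_smooth : smooth_on setT rho. Proof. by case: hrho. Qed.

Lemma kernel_continuous : continuous rho.
Proof. by move=> x; have [] := rho_smooth [::] (x := x) I. Qed.

Lemma kernel_partial_continuous i : continuous (partial i rho).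
Proof. by move=> x; have [] := rho_smooth [:: i] (x := x) I. Qed.

Lemma kernel_is_derive i x :
  is_derive x (delta_mx ord0 i) rho (partial i rho x).
Proof. by apply: derivableP; have [_] := rho_smooth [::] (x := x) I. Qed.

Lemma kernel_support z : rho z != 0 -> enorm z <= 1.
Proof.
by case: hrho => _ + _ _ rz; apply; apply: subset_closure.
Qed.

(** Off the closed support of [rho] the kernel vanishes in a whole neighbourhood, hence so does its
    derivative. *)
Lemma kernel_partial_support i z : partial i rho z != 0 -> enorm z <= 1.
Proof.
move=> pz; case: hrho => _ + _ _; apply; apply: contrapT => nz.
move/negP : pz; apply; apply/eqP.
have rho0 : \forall y \near z, cst 0 y = rho y.
  have oC := @closed_openC _ _ (@closed_closure _ [set z | rho z != 0]).
  have := open_nbhs_nbhs (conj oC nz).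
  apply: filterS => y ny; apply: contrapT => /eqP; rewrite eq_sym => ry.
  by apply: ny; apply: subset_closure.
have : is_derive z (delta_mx ord0 i) rho 0.
  exact: near_eq_is_derive rho0 (is_derive_cst _ _ _).
by case.
Qed.

Lemma grad_kernel_support z w : 1 < enorm z -> dot (grad rho z) w = 0.
Proof.
move=> z1; rewrite /dot big1// => i _; rewrite mxE.
have [->|/kernel_partial_support] := eqVneq (partial i rho z) 0.
  by rewrite mul0r.
by rewrite leNgt z1.
Qed.

(** The chain-rule form of the i-th partial derivative of [rescale rho l]; continuity and bounds are
    inherited directly from [partial i rho]. *)
Definition rescale_partial i x : R :=
  l ^- d * (l^-1 * partial i rho (l^-1 *: x)).

Lemma rescale_continuous : continuous (rescale rho l).
Proof.
move=> x; apply: (@continuousM R 'rV[R]_d (cst (l ^- d)));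
    first exact: cst_continuous.
apply: (@continuous_comp _ _ _ (fun x : 'rV[R]_d => l^-1 *: x) rho).
  exact: scaler_continuous.
exact: kernel_continuous.
Qed.

Lemma rescale_partial_continuous i : continuous (rescale_partial i).
Proof.
move=> x; apply: (@continuousM R 'rV[R]_d (cst (l ^- d)));
    first exact: cst_continuous.
apply: (@continuousM R 'rV[R]_d (cst l^-1)); first exact: cst_continuous.
apply: (@continuous_comp _ _ _ (fun x : 'rV[R]_d => l^-1 *: x) (partial i rho)).
  exact: scaler_continuous.
exact: kernel_partial_continuous.
Qed.

Lemma rescale_support y : rescale rho l y != 0 -> enorm y <= l.
Proof.
rewrite /rescale mulf_eq0 negb_or => /andP[_ /kernel_support].
by rewrite enormZ gtr0_norm ?invr_gt0// ler_pdivrMl// mulr1.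
Qed.

Lemma rescale_bounded : exists M, forall y, `|rescale rho l y| <= M.
Proof.
have [M rM] := bounded_of_support kernel_continuous kernel_support.
exists (l ^- d * M) => y; rewrite normrM ger0_norm ?invr_ge0 ?exprn_ge0//.
by rewrite ler_wpM2l ?invr_ge0 ?exprn_ge0.
Qed.

Lemma rescale_partial_bounded i : exists M, forall y,
    `|rescale_partial i y| <= M.
Proof.
have [M rM] := bounded_of_support (@kernel_partial_continuous i)
  (@kernel_partial_support i).
exists (l ^- d * (l^-1 * M)) => y.
rewrite !normrM ger0_norm ?invr_ge0 ?exprn_ge0//.
rewrite ler_wpM2l ?invr_ge0 ?exprn_ge0//.
rewrite ger0_norm ?invr_ge0//.
by rewrite ler_wpM2l ?invr_ge0.
Qed.

Lemma rescale_is_derive i x :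
  is_derive x (delta_mx ord0 i) (rescale rho l) (rescale_partial i x).
Proof.
rewrite /rescale /rescale_partial.
apply: is_deriveZ; apply: is_derive_cvg.
have [dr <-] := kernel_is_derive i (l^-1 *: x).
(* The difference quotient of step h is l^-1 times that of [rho] with step l^-1 h, and h |-> l^-1 h
   maps punctured neighbourhoods of 0 to such neighbourhoods. *)
rewrite [X in X @ _ --> _](_ : _ = (fun h => l^-1 * ((l^-1 * h)^-1 *:
   (rho ((l^-1 * h) *: delta_mx ord0 i + l^-1 *: x) - rho (l^-1 *: x)))));
       last first.
  apply/funext => h; rewrite [l^-1 *: (_ + _)]scalerDr scalerA invfM invrK.
  by rewrite /GRing.scale /= !mulrA mulVf ?gt_eqF ?mul1r.
apply: cvgM; first exact: cvg_cst.
have cv : l^-1 * h @[h --> (0 : R)^'] --> (0 : R)^'.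
  have c0 : l^-1 * h @[h --> (0 : R)] --> (0 : R).
    by rewrite -[X in _ --> X](mulr0 l^-1); apply: cvgM;
        [exact: cvg_cst|exact: cvg_id].
  move=> P dP; have P0 : \forall h \near (0 : R),
      l^-1 * h != 0 -> P (l^-1 * h) := c0 _ dP.
  apply: filterS P0 => h Ph h0; apply: Ph.
  by rewrite mulf_neq0// invr_neq0// gt_eqF.
exact: (cvg_comp _ _ cv dr).
Qed.

Lemma mollifyE (n m : nat) (f : 'rV[R]_d -> 'M[R]_(n, m)) x
    (i : 'I_n) (j : 'I_m) :
  mollify rho l f x i j = convol (rescale rho l) (fun y => f y i j) x.
Proof. by rewrite mxE. Qed.

End kernel.

Section inner_distance.
Context {R : realType} {d : nat}.

(** The hypothesis bounds the distance to the boundary of B, not to its complement, so connectedness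
    is used: the parameters t in [0, 1] with x + t h in B form a nonempty, relatively open set. It
    is also relatively closed, since a boundary point on the segment would lie within l of x. *)
Lemma add_in_of_set_dist (A B : set 'rV[R]_d) (l : R) (x h : 'rV[R]_d) :
  open B -> A x -> B x -> (l%:E < set_dist A (boundary B))%E ->
  enorm h <= l -> B (x + h).
Proof.
move=> oB Ax Bx lAB hl.
pose g (t : R) := x + t *: h.
have cg : continuous g.
  by move=> t; apply: cvgD; [exact: cvg_cst|exact: scalel_continuous].
have gB : `[0, 1]%classic `&` g @^-1` B = `[0, 1]%classic.
  apply: (segment_connected (a := 0) (b := 1)).
  - by exists 0; split; rewrite /= ?in_itv/= ?lexx ?ler01// /g scale0r addr0.
  - by exists (g @^-1` B) => //; exact: open_comp (fun t _ => cg t) oB.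
  - exists (g @^-1` closure B).
      apply: preimage_closed; last exact: closed_closure.
      by move=> t _; exact: cg.
    apply/seteqP; split => t [t01 gt]; split => //; first exact: subset_closure.
    apply: contrapT => nB.
    have bt : boundary B (g t).
      by split => // /interior_subset.
    have : (set_dist A (boundary B) <= (enorm (x - g t))%:E)%E.
      by apply: ereal_inf_lbound; exists x => //; exists (g t).
    rewrite leNgt => /negP; apply; apply: le_lt_trans lAB.
    rewrite lee_fin /g opprD addNKr enormN enormZ.
    move: t01; rewrite /= in_itv/= => /andP[t0 t1].
    by rewrite ger0_norm// (le_trans _ hl)// ler_piMl// enorm_ge0.
have : (`[0, 1]%classic `&` g @^-1` B) 1.
  by rewrite gB /= in_itv/= ler01 lexx.
by move=> [_]; rewrite /= /g scale1r.
Qed.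

End inner_distance.

(** * The flux of fields extended by zero *)

Section parametric_measurability.
Context {R : realType}.

(** Tonelli applies to the positive and negative parts, and [fine] is measurable, so no
    integrability of the sections enters. *)
Lemma measurable_Rintegral {d1 d2} {T1 : measurableType d1}
    {T2 : measurableType d2} (m : {sigma_finite_measure set T2 -> \bar R})
    (F : T1 * T2 -> R) :
  measurable_fun setT F -> measurable_fun setT (fun x => \int[m]_y F (x, y)).
Proof.
move=> mF; have mE : measurable_fun setT (EFin \o F) by exact/measurable_EFinP.
apply: (measurableT_comp (fine_measurable measurableT)).
under eq_fun do rewrite integralE.
apply: emeasurable_funB.
- rewrite (_ : (fun x => _) = fubini_F m (EFin \o F)^\+%E).
    apply: measurable_fun_fubini_tonelli_F; first exact: measurable_funepos.
    by move=> x; exact: funepos_ge0.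
  by apply/funext => x; apply: eq_integral => y _; rewrite !funeposE.
- rewrite (_ : (fun x => _) = fubini_F m (EFin \o F)^\-%E).
    apply: measurable_fun_fubini_tonelli_F; first exact: measurable_funeneg.
    by move=> x; exact: funeneg_ge0.
  by apply/funext => x; apply: eq_integral => y _; rewrite !funenegE.
Qed.

Context {disp : measure_display} {T : measurableType disp} {d : nat}.
Implicit Types f g : T -> 'rV[R]_d.

Lemma measurable_fun_coord f i : measurable_fun setT f ->
  measurable_fun setT (fun x => f x ord0 i).
Proof. by move=> mf; exact: (measurableT_comp (measurable_coord i) mf). Qed.

Lemma measurable_fun_addrV f g : measurable_fun setT f ->
  measurable_fun setT g -> measurable_fun setT (fun x => f x + g x).
Proof.
move=> mf mg; apply/measurable_fun_rVP => i; under eq_fun do rewrite mxE.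
by apply: measurable_funD; exact: measurable_fun_coord.
Qed.

Lemma measurable_fun_scalerV (c : R) f : measurable_fun setT f ->
  measurable_fun setT (fun x => c *: f x).
Proof.
move=> mf; apply/measurable_fun_rVP => i; under eq_fun do rewrite mxE.
by apply: measurable_funM => //; exact: measurable_fun_coord.
Qed.

Lemma measurable_fun_dot f g : measurable_fun setT f ->
  measurable_fun setT g -> measurable_fun setT (fun x => dot (f x) (g x)).
Proof.
move=> mf mg; rewrite /dot; apply: measurable_sum => i.
by apply: measurable_funM; exact: measurable_fun_coord.
Qed.

End parametric_measurability.

Section zero_extension.
Context {R : realType} {d : nat} {disp : measure_display}
  {T : measurableType disp}.
Variable mu : {measure set T -> \bar R}.
Implicit Types (U : set T) (v : T -> 'rV[R]_d).

Definition zero_ext U v : T -> 'rV[R]_d := fun x => if x \in U then v x else 0.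

Lemma zero_ext_in U v x : U x -> zero_ext U v x = v x.
Proof. by move=> Ux; rewrite /zero_ext mem_set. Qed.

Lemma measurable_zero_ext U v : measurable U -> measurable_fun U v ->
  measurable_fun setT (zero_ext U v).
Proof.
move=> mU mv; apply/measurable_fun_rVP => i.
rewrite (_ : (fun x => _) = (fun x => v x ord0 i) \_ U); last first.
  by apply/funext => x; rewrite /zero_ext /patch; case: ifP; rewrite ?mxE.
apply/(measurable_restrictT _ mU);
    exact: (measurableT_comp (measurable_coord i) mv).
Qed.

Lemma integrable_zero_ext U v i : measurable U -> in_Lp_vec mu 1 U v ->
  mu.-integrable setT (fun x => (zero_ext U v x ord0 i)%:E).
Proof.
move=> mU [mv]; rewrite /Lnorm_on Lnorm1 => vfin; apply/integrableP; split.
  apply/measurable_EFinP; apply: measurable_fun_coord.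
  exact: measurable_zero_ext.
apply: le_lt_trans vfin; apply: ge0_ae_le_integral => //; apply: aeW => x /=.
rewrite /zero_ext /patch; case: ifP => _ /=; last by rewrite mxE normr0.
by rewrite lee_fin (le_trans (coord_le_enorm _ _))// ler_norm.
Qed.

End zero_extension.

Section dot.
Context {R : realType} {d : nat}.
Implicit Types x y z : 'rV[R]_d.

Lemma dotDr x y z : dot x (y + z) = dot x y + dot x z.
Proof.
by rewrite /dot -big_split; apply: eq_bigr => i _; rewrite mxE mulrDr.
Qed.

Lemma dotDl x y z : dot (x + y) z = dot x z + dot y z.
Proof.
by rewrite /dot -big_split; apply: eq_bigr => i _; rewrite mxE mulrDl.
Qed.

Lemma incrementD h (v w : 'rV[R]_d -> 'rV[R]_d) x :
  increment h (fun y => v y + w y) x = increment h v x + increment h w x.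
Proof. by rewrite /increment opprD addrACA. Qed.

Lemma tensorE (v w : 'rV[R]_d -> 'rV[R]_d) x i j :
  tensor v w x i j = v x ord0 i * w x ord0 j.
Proof. by rewrite /tensor mxE big_ord1 mxE. Qed.

End dot.

Section global_flux.
Context {R : realType} {d : nat}.
Local Notation mu := (lebesgue_rV R d).
Variables (k : flux_kind) (rho : 'rV[R]_d -> R) (l : R).
Hypotheses (hrho : mollification_kernel rho) (l_gt0 : 0 < l).
Implicit Types (v w A B : 'rV[R]_d -> 'rV[R]_d) (x : 'rV[R]_d).

Definition CET_convol v1 v2 v3 x : R :=
  \sum_i \sum_j
    (convol (rescale rho l) (fun y => v1 y ord0 i) x *
       convol (rescale rho l) (fun y => v2 y ord0 j) x -
     convol (rescale rho l) (fun y => v1 y ord0 i * v2 y ord0 j) x) *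
    convol (rescale_partial rho l j) (fun y => v3 y ord0 i) x.

(* For integrable fields this is [flux], with the derivative in the CET case
   moved onto the kernel. *)
Definition global_flux v1 v2 v3 : 'rV[R]_d -> R :=
  match k with
  | DR => DR_flux rho l v1 v2 v3
  | CET => CET_convol v1 v2 v3
  end.

Section restriction.
Variables (O U : set 'rV[R]_d).
Hypotheses (oO : open O) (OU : O `<=` U)
  (OlU : forall x h, O x -> enorm h <= l -> U (x + h)).

(** For |z| > 1 the gradient of the kernel vanishes; for |z| <= 1 both x and x + l z lie in U. *)
Lemma DR_integrand_zero_ext v1 v2 v3 x z : O x ->
  DR_integrand rho l v1 v2 v3 x z =
  DR_integrand rho l (zero_ext U v1) (zero_ext U v2) (zero_ext U v3) x z.
Proof.
move=> Ox; have [z1|z1] := leP (enorm z) 1; last first.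
  by rewrite /DR_integrand !(grad_kernel_support hrho)// !mul0r.
rewrite /DR_integrand /increment !zero_ext_in//; try exact: OU;
  by apply: OlU => //; rewrite enormZ gtr0_norm// ler_piMr// ltW.
Qed.

Lemma mul_support_zero_ext (K f g : 'rV[R]_d -> R) x y : O x ->
  (forall z, K z != 0 -> enorm z <= l) -> {in U, f =1 g} ->
  K y * f (x - y) = K y * g (x - y).
Proof.
move=> Ox Kl fg; have [->|/Kl Ky] := eqVneq (K y) 0; first by rewrite !mul0r.
by rewrite fg// inE; apply: OlU; rewrite ?enormN.
Qed.

Lemma convol_zero_ext (K f g : 'rV[R]_d -> R) x : O x ->
  (forall z, K z != 0 -> enorm z <= l) -> {in U, f =1 g} ->
  convol K f x = convol K g x.
Proof.
by move=> Ox Kl fg; apply: eq_Rintegral => y _; exact: mul_support_zero_ext.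
Qed.

(** In the CET case the mollified third field agrees with the convolution of its extension on all of
    O, which is open, so the derivatives at x agree too; integrability of the extension then moves
    the derivative onto the kernel. *)
Lemma flux_zero_ext v1 v2 v3 x : O x ->
  (forall i, mu.-integrable setT (fun y => (zero_ext U v3 y ord0 i)%:E)) ->
  flux k rho l v1 v2 v3 x =
  global_flux (zero_ext U v1) (zero_ext U v2) (zero_ext U v3) x.
Proof.
move=> Ox int3; rewrite /global_flux /flux; case: k.
  by apply: eq_Rintegral => z _; exact: DR_integrand_zero_ext.
rewrite /CET_flux /frobenius /CET_convol.
apply: eq_bigr => i _; apply: eq_bigr => j _; congr (_ * _).
  rewrite mxE [X in _ + X]mxE tensorE !mollifyE; congr (_ * _ - _).
  - apply: convol_zero_ext => //; first exact: rescale_support.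
    by move=> y /set_mem Uy; rewrite zero_ext_in.
  - apply: convol_zero_ext => //; first exact: rescale_support.
    by move=> y /set_mem Uy; rewrite zero_ext_in.
  - apply: convol_zero_ext => //; first exact: rescale_support.
    by move=> y /set_mem Uy; rewrite tensorE !zero_ext_in.
rewrite mxE /partial.
have [M rM] := rescale_bounded hrho l_gt0.
have [N rN] := rescale_partial_bounded hrho l_gt0 j.
have der := is_derive_convol x (rescale_continuous hrho)
  (rescale_partial_continuous hrho (i := j)) rM rN
  (rescale_is_derive hrho l_gt0 j) (int3 i).
suff : is_derive x (delta_mx ord0 j) (fun y => mollify rho l v3 y ord0 i)
  (convol (rescale_partial rho l j) (fun y => zero_ext U v3 y ord0 i) x) by
      case.
apply: near_eq_is_derive der.
have := open_nbhs_nbhs (conj oO Ox); apply: filterS => y Oy.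
rewrite mollifyE; apply/esym/convol_zero_ext => //;
    first exact: rescale_support.
by move=> z /set_mem Uz; rewrite zero_ext_in.
Qed.

(** In the CET case only the mollified product is mentioned: the convolutions of single components
    converge for integrable fields. *)
Definition global_flux_defined v1 v2 v3 x : Prop :=
  match k with
  | DR => mu.-integrable setT (fun z => (DR_integrand rho l v1 v2 v3 x z)%:E)
  | CET => forall i j, mu.-integrable setT (fun y =>
      (rescale rho l y * (v1 (x - y) ord0 i * v2 (x - y) ord0 j))%:E)
  end.

Lemma flux_defined_zero_ext v1 v2 v3 x : O x ->
  flux_defined_at k rho l v1 v2 v3 x ->
  global_flux_defined (zero_ext U v1) (zero_ext U v2) (zero_ext U v3) x.
Proof.
move=> Ox; rewrite /global_flux_defined /flux_defined_at; case: k.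
  by under eq_fun do rewrite DR_integrand_zero_ext//.
move=> intv i j; apply: eq_integrable (intv i j) => // y _.
congr EFin; rewrite tensorE.
apply: (@mul_support_zero_ext _ (fun y => v1 y ord0 i * v2 y ord0 j)
  (fun y => zero_ext U v1 y ord0 i * zero_ext U v2 y ord0 j)) => //.
  exact: rescale_support.
by move=> z /set_mem Uz; rewrite !zero_ext_in.
Qed.

End restriction.
End global_flux.

Section global_flux_theory.
Context {R : realType} {d : nat}.
Local Notation mu := (lebesgue_rV R d).
Variables (k : flux_kind) (rho : 'rV[R]_d -> R) (l : R).
Hypotheses (hrho : mollification_kernel rho) (l_gt0 : 0 < l).
Implicit Types (v w A B : 'rV[R]_d -> 'rV[R]_d) (x : 'rV[R]_d).

Lemma measurable_grad_kernel : measurable_fun setT (grad rho).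
Proof.
apply/measurable_fun_rVP => i; under eq_fun do rewrite mxE.
exact: continuous_measurable_rV (kernel_partial_continuous hrho (i := i)).
Qed.

(** The field values are arbitrary measurable functions here, so that the lemma serves both in z
    alone and jointly in ((x, t), z). *)
Lemma measurable_DR_form {disp} {T : measurableType disp} (c : R)
    (z p1 q1 p2 q2 p3 q3 : T -> 'rV[R]_d) :
  measurable_fun setT z ->
  measurable_fun setT p1 -> measurable_fun setT q1 ->
  measurable_fun setT p2 -> measurable_fun setT q2 ->
  measurable_fun setT p3 -> measurable_fun setT q3 ->
  measurable_fun setT (fun t => dot (grad rho (z t)) (c *: (p1 t - q1 t)) *
    dot (p2 t - q2 t) (p3 t - q3 t)).
Proof.
move=> mz mp1 mq1 mp2 mq2 mp3 mq3.
have mB (p q : T -> 'rV[R]_d) :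
    measurable_fun setT p -> measurable_fun setT q ->
    measurable_fun setT (fun t => p t - q t).
  move=> mp mq; under eq_fun do rewrite -scaleN1r.
  by apply: measurable_fun_addrV => //; exact: measurable_fun_scalerV.
apply: measurable_funM; apply: measurable_fun_dot.
- exact: (measurableT_comp measurable_grad_kernel mz).
- by apply: measurable_fun_scalerV; exact: mB.
- exact: mB.
- exact: mB.
Qed.

Lemma measurable_DR_integrand v1 v2 v3 x : measurable_fun setT v1 ->
  measurable_fun setT v2 -> measurable_fun setT v3 ->
  measurable_fun setT (DR_integrand rho l v1 v2 v3 x).
Proof.
move=> mv1 mv2 mv3; apply: measurable_DR_form => //.
- exact: (measurableT_comp mv1 (measurable_addrV x l)).
- exact: (measurableT_comp mv2 (measurable_addrV x l)).
- exact: (measurableT_comp mv3 (measurable_addrV x l)).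
Qed.

(** In the DR case x itself must avoid the null sets, because the increments contain the value at x;
    for such x the map z |-> x + l z pulls null sets back to null sets. In the CET case only
    integrals occur and equality holds at every x. *)
Lemma global_flux_ae_eq v1 v2 v3 w1 w2 w3 :
  measurable_fun setT v1 -> measurable_fun setT v2 -> measurable_fun setT v3 ->
  measurable_fun setT w1 -> measurable_fun setT w2 -> measurable_fun setT w3 ->
  {ae mu, forall x, v1 x = w1 x} -> {ae mu, forall x, v2 x = w2 x} ->
  {ae mu, forall x, v3 x = w3 x} ->
  {ae mu, forall x, global_flux k rho l v1 v2 v3 x =
                    global_flux k rho l w1 w2 w3 x}.
Proof.
move=> mv1 mv2 mv3 mw1 mw2 mw3 vw1 vw2 vw3; rewrite /global_flux; case: k.
  have l0 : l != 0 by rewrite gt_eqF.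
  apply: filterS3 (vw1) (vw2) (vw3) => x x1 x2 x3; rewrite /DR_flux /Rintegral.
  congr fine; apply: ae_eq_integral => //.
  - by apply/measurable_EFinP; exact: measurable_DR_integrand.
  - by apply/measurable_EFinP; exact: measurable_DR_integrand.
  - have := ae_rV_affine x l0 vw3; have := ae_rV_affine x l0 vw2.
    have := ae_rV_affine x l0 vw1; apply: filterS3 => z z1 z2 z3 _.
    by rewrite /DR_integrand /increment x1 x2 x3 z1 z2 z3.
have aeM i (v w : 'rV[R]_d -> 'rV[R]_d) : {ae mu, forall x, v x = w x} ->
    {ae mu, forall x, v x ord0 i = w x ord0 i}.
  by apply: filterS => x ->.
apply: aeW => x; rewrite /CET_convol.
apply: eq_bigr => i _; apply: eq_bigr => j _; congr ((_ * _ - _) * _).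
- apply: convol_ae_eq (aeM _ _ _ vw1); try exact: measurable_fun_coord.
  exact: rescale_continuous.
- apply: convol_ae_eq (aeM _ _ _ vw2); try exact: measurable_fun_coord.
  exact: rescale_continuous.
- apply: convol_ae_eq.
  + exact: rescale_continuous.
  + by apply: measurable_funM; exact: measurable_fun_coord.
  + by apply: measurable_funM; exact: measurable_fun_coord.
  + by apply: filterS2 vw1 vw2 => y -> ->.
- apply: convol_ae_eq (aeM _ _ _ vw3); try exact: measurable_fun_coord.
  exact: rescale_partial_continuous.
Qed.

(** [W C] puts C in slot [i0] and keeps [w] elsewhere, so one statement covers the three slots.
    Splitting an integral needs both parts to converge: single components do by integrability of A
    and B, the DR integrand and the CET products by the definedness hypotheses. *)
Lemma global_flux_additive (w : 'I_3 -> 'rV[R]_d -> 'rV[R]_d)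
    (i0 : 'I_3) A B x :
  let W C i := if i == i0 then C else w i in
  (forall i, mu.-integrable setT (fun y => (A y ord0 i)%:E)) ->
  (forall i, mu.-integrable setT (fun y => (B y ord0 i)%:E)) ->
  global_flux_defined k rho l (W A 0) (W A 1) (W A 2) x ->
  global_flux_defined k rho l (W B 0) (W B 1) (W B 2) x ->
  let AB y := A y + B y in
  global_flux k rho l (W AB 0) (W AB 1) (W AB 2) x =
  global_flux k rho l (W A 0) (W A 1) (W A 2) x +
  global_flux k rho l (W B 0) (W B 1) (W B 2) x.
Proof.
move=> W iA iB + + AB; rewrite /W {W}.
have [M rM] := rescale_bounded hrho l_gt0.
have cA i := integrable_convol x (rescale_continuous hrho (l := l)) rM (iA i).
have cB i := integrable_convol x (rescale_continuous hrho (l := l)) rM (iB i).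
have cAB i : convol (rescale rho l) (fun y => AB y ord0 i) x =
    convol (rescale rho l) (fun y => A y ord0 i) x +
    convol (rescale rho l) (fun y => B y ord0 i) x.
  by apply: convolD => // y; rewrite /AB mxE.
have dAB i j : convol (rescale_partial rho l j) (fun y => AB y ord0 i) x =
    convol (rescale_partial rho l j) (fun y => A y ord0 i) x +
    convol (rescale_partial rho l j) (fun y => B y ord0 i) x.
  have [N rN] := rescale_partial_bounded hrho l_gt0 j.
  have cK := rescale_partial_continuous hrho (l := l) (i := j).
  apply: convolD => [y||]; first by rewrite /AB mxE.
  - exact: integrable_convol cK rN (iA i).
  - exact: integrable_convol cK rN (iB i).
rewrite /global_flux /global_flux_defined; case: k => defA defB.
  rewrite /DR_flux -RintegralD//; apply: eq_Rintegral => z _.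
  rewrite /DR_integrand.
  case: i0 {defA defB} => [[|[|[|//]]]] i0 /=; rewrite incrementD.
  - by rewrite scalerDr dotDr mulrDl.
  - by rewrite dotDl mulrDr.
  - by rewrite dotDr mulrDr.
rewrite /CET_convol -big_split; apply: eq_bigr => i _.
rewrite -big_split; apply: eq_bigr => j _ /=.
move: (defA i j) (defB i j) => {defA defB}.
case: i0 => [[|[|[|//]]]] i0 /= defA defB.
- rewrite cAB (convolD (f := fun y => AB y ord0 i * w 1 y ord0 j)
    (g := fun y => A y ord0 i * w 1 y ord0 j)
    (h := fun y => B y ord0 i * w 1 y ord0 j) _ defA defB); first by ring.
  by move=> y; rewrite /AB mxE mulrDl.
- rewrite cAB (convolD (f := fun y => w 0 y ord0 i * AB y ord0 j)
    (g := fun y => w 0 y ord0 i * A y ord0 j)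
    (h := fun y => w 0 y ord0 i * B y ord0 j) _ defA defB); first by ring.
  by move=> y; rewrite /AB mxE mulrDr.
- by rewrite dAB; ring.
Qed.

Lemma measurable_convol_param {disp} {T : measurableType disp}
    (K : 'rV[R]_d -> R) (f : 'rV[R]_d * T -> R) : continuous K ->
  measurable_fun setT f ->
  measurable_fun setT
    (fun z : 'rV[R]_d * T => convol K (fun y => f (y, z.2)) z.1).
Proof.
move=> cK mf; pose F (z : ('rV[R]_d * T) * 'rV[R]_d) :=
  K z.2 * f (z.1.1 - z.2, z.1.2).
apply: (measurable_Rintegral mu (F := F)); apply: measurable_funM.
  exact: (measurableT_comp (continuous_measurable_rV cK) measurable_snd).
apply: (measurableT_comp mf); apply: measurable_fun_pair.
  under eq_fun do rewrite -scaleN1r.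
  apply: measurable_fun_addrV.
    exact: (measurableT_comp measurable_fst measurable_fst).
  by apply: measurable_fun_scalerV; exact: measurable_snd.
exact: (measurableT_comp measurable_snd measurable_fst).
Qed.

Lemma measurable_global_flux_param {disp} {T : measurableType disp}
    (u : 'rV[R]_d * T -> 'rV[R]_d) : measurable_fun setT u ->
  measurable_fun setT (fun z : 'rV[R]_d * T =>
    let v x := u (x, z.2) in global_flux k rho l v v v z.1).
Proof.
move=> mu_; rewrite /global_flux; case: k.
  pose F (z : ('rV[R]_d * T) * 'rV[R]_d) :=
    DR_integrand rho l (fun x => u (x, z.1.2)) (fun x => u (x, z.1.2))
      (fun x => u (x, z.1.2)) z.1.1 z.2.
  apply: (measurable_Rintegral mu (F := F)).
  have m1 : measurable_fun setT (fun z : ('rV[R]_d * T) * 'rV[R]_d =>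
      u (z.1.1 + l *: z.2, z.1.2)).
    apply: (measurableT_comp mu_); apply: measurable_fun_pair.
      apply: measurable_fun_addrV.
        exact: (measurableT_comp measurable_fst measurable_fst).
      by apply: measurable_fun_scalerV; exact: measurable_snd.
    exact: (measurableT_comp measurable_snd measurable_fst).
  have m2 : measurable_fun setT (fun z : ('rV[R]_d * T) * 'rV[R]_d =>
      u (z.1.1, z.1.2)).
    apply: (measurableT_comp mu_); apply: measurable_fun_pair.
      exact: (measurableT_comp measurable_fst measurable_fst).
    exact: (measurableT_comp measurable_snd measurable_fst).
  by apply: measurable_DR_form => //; exact: measurable_snd.
rewrite /CET_convol /=; apply: measurable_sum => i; apply: measurable_sum => j.
have mui i' : measurable_fun setT (fun z => u z ord0 i').
  exact: measurable_fun_coord.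
have cK := rescale_continuous hrho (l := l).
apply: measurable_funM; first apply: measurable_funB;
    first apply: measurable_funM.
- exact: (measurable_convol_param cK (mui i)).
- exact: (measurable_convol_param cK (mui j)).
- exact: (measurable_convol_param cK (measurable_funM (mui i) (mui j))).
- exact: (measurable_convol_param
    (rescale_partial_continuous hrho (l := l) (i := j)) (mui i)).
Qed.

End global_flux_theory.

(** * Convergence for fixed fields and integrable domination *)

Section extended_limits.
Context {R : realType} {T : Type} {F : set_system T} {FF : Filter F}.
Implicit Types f : T -> \bar R.

Lemma ge0_cvge0 f : (forall x, 0 <= f x)%E ->
  (forall e : R, 0 < e -> \forall x \near F, (f x <= e%:E)%E) ->
  f @ F --> 0%E.
Proof.
move=> f0 fe; apply/fine_cvgP; split.
  apply: filterS (fe 1 ltr01) => x fx.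
  by rewrite ge0_fin_numE// (le_lt_trans fx)// ltry.
apply/cvgrPdist_le => e e0; apply: filterS (fe _ e0) => x fx /=.
rewrite sub0r normrN ger0_norm ?fine_ge0//.
by rewrite -lee_fin fineK// ge0_fin_numE// (le_lt_trans fx)// ltry.
Qed.

Lemma cvge0_near_le f : f @ F --> 0%E ->
  forall e : R, 0 < e -> \forall x \near F, (f x <= e%:E)%E.
Proof.
move=> f0 e e0; have : nbhs (0%E : \bar R) [set y : \bar R | (y < e%:E)%E].
  apply: open_nbhs_nbhs; split; first exact: open_ereal_lt_ereal.
  by rewrite /= lte_fin.
by move=> /f0 ?; near do apply: ltW.
Unshelve. all: by end_near. Qed.

End extended_limits.

Section Hoelder_integrable.
Context {disp : measure_display} {T : measurableType disp} {R : realType}.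
Variable mu : {measure set T -> \bar R}.

(* Young's inequality in the crude form prod_i a_i <= K sum_i a_i^(p_i) needs
   no case distinction on infinite exponents: those contribute s = 0. *)
Lemma Lnorm_on_powR_bound (D : set T) (p : \bar R) (a : T -> R) :
  measurable D -> measurable_fun D a -> (forall t, 0 <= a t) -> (1 <= p)%E ->
  (Lnorm_on mu p D a < +oo)%E ->
  exists sKb : R * R * (T -> R), let: (s, K, b) := sKb in
    [/\ (p^-1 = s%:E)%E, 0 <= K, (forall t, 0 <= b t),
        mu.-integrable D (EFin \o b) &
        {ae mu, forall t, D t -> forall S, b t <= S -> a t <= K * S `^ s}].
Proof.
move=> mD ma a0; case: p => [r|_|//].
- rewrite lee_fin => r1; have r0 : 0 < r by exact: lt_le_trans ltr01 r1.
  rewrite /Lnorm_on unlock => afin.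
  exists (r^-1, 1, fun t => a t `^ r); split => //.
  + by rewrite inver gt_eqF.
  + by move=> t; exact: powR_ge0.
  + apply/integrableP; split.
      apply/measurable_EFinP; exact: (measurableT_comp (measurable_powR r) ma).
    (* An infinite integral of a^r would make the norm infinite. *)
    rewrite ltey; apply/eqP => ioo; move: afin.
    rewrite (_ : (\int[mu]_x _)%E = +oo%E) ?poweRyr ?ltxx// ?invr_eq0 ?gt_eqF//.
    rewrite -ioo [RHS]integral_mkcond; apply: eq_integral => t _.
    rewrite /patch; case: ifP => _ /=; first by rewrite !ger0_norm ?powR_ge0.
    by rewrite normr0 powR0 ?gt_eqF.
  + apply: aeW => t _ S aS; rewrite mul1r.
    have -> : a t = (a t `^ r) `^ r^-1.
      by rewrite -powRrM mulfV ?gt_eqF// powRr1.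
    apply: ge0_ler_powR => //; rewrite ?invr_ge0 ?(ltW r0)// nnegrE ?powR_ge0//.
    by apply: le_trans aS; exact: powR_ge0.
- rewrite /Lnorm_on unlock => afin.
  have [K K0 aK] : exists2 K : R, 0 <= K & {ae mu, forall t, D t -> a t <= K}.
    (* The norm of exponent +oo is an essential supremum when the whole space has positive measure;
       otherwise every property holds almost everywhere, and K = 0 will do. *)
    move: afin; case: ifPn => [mu0 afin|].
      pose e := ess_sup mu (abse \o ((EFin \o a) \_ D)).
      exists (Num.max 0 (fine e)); first by rewrite le_max lexx.
      have := ess_sup_ge mu (abse \o ((EFin \o a) \_ D)).
      apply: filterS => t + Dt; rewrite /= /patch mem_set//= ger0_norm// -/e.
      move: (afin); rewrite -/e; case: e => [e'|//|//] _; rewrite lee_fin => ae.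
      by rewrite le_max ae orbT.
    rewrite -leNgt measure_le0 => /eqP mu0 _; exists 0 => //.
    by exists setT; split.
  exists (0, K, fun=> 0); split => //.
  + exact: integrable0.
  + by apply: filterS aK => t aK Dt S _; rewrite powRr0 mulr1; exact: aK.
Qed.

(** With S the sum of the b_i, each a_i is at most K_i S^(s_i) almost everywhere. As the s_i sum to
    1, the product of the a_i is at most (prod_i K_i) S, which is integrable. *)
Lemma integrable_prod (D : set T) n (p : 'I_n -> \bar R) (a : 'I_n -> T -> R) :
  measurable D -> (forall i, measurable_fun D (a i)) ->
  (forall i t, 0 <= a i t) -> (forall i, 1 <= p i)%E ->
  (\sum_(i < n) (p i)^-1 = 1)%E ->
  (forall i, Lnorm_on mu (p i) D (a i) < +oo)%E ->
  mu.-integrable D (fun t => (\prod_(i < n) a i t)%:E).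
Proof.
move=> mD ma a0 p1 psum afin.
have /choice[sKb H] i := Lnorm_on_powR_bound mD (ma i) (a0 i) (p1 i) (afin i).
pose s i := (sKb i).1.1; pose K i := (sKb i).1.2; pose b i := (sKb i).2.
have {}H i : [/\ ((p i)^-1 = (s i)%:E)%E, 0 <= K i,
    (forall t, 0 <= b i t), mu.-integrable D (EFin \o b i) &
    {ae mu, forall t, D t -> forall S, b i t <= S -> a i t <= K i * S `^ s i}].
  by move: (H i); rewrite /s /K /b; case: (sKb i) => [[? ?] ?].
have s1 : \sum_(i < n) s i = 1.
  apply: EFin_inj; rewrite -sumEFin -psum; apply: eq_bigr => i _.
  by have [->] := H i.
pose S t := \sum_(i < n) b i t.
have b0 i t : 0 <= b i t by have [_ _ ->] := H i.
have S0 t : 0 <= S t by apply: sumr_ge0 => i _; exact: b0.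
have bS i t : b i t <= S t.
  by rewrite /S (bigD1 i)//= lerDl; apply: sumr_ge0 => j _; exact: b0.
have prodS t : \prod_(i < n) (S t) `^ s i = S t.
  (* Since 0^0 = 1, a zero of S needs a factor with nonzero exponent; there is one because the
     exponents sum to 1. *)
  have [St0|St0] := eqVneq (S t) 0.
    have [i si] : exists i, s i != 0.
      apply: contrapT => /forallNP s0; move: s1; rewrite big1 => [/eqP|i _].
        by rewrite eq_sym oner_eq0.
      by apply/eqP/negPn/negP; exact: s0.
    by rewrite (bigD1 i)//= St0 powR0// mul0r.
  rewrite -[RHS](powRr1 (S0 t)) -s1.
  elim/big_rec2 : _ => [|i x y _ ->]; first by rewrite powRr0.
  by rewrite powRD ?St0 ?implybT.
have iS : mu.-integrable D (EFin \o S).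
  rewrite (_ : EFin \o S = fun t => \sum_(i < n) (b i t)%:E)%E; last first.
    by apply/funext => t; rewrite /= sumEFin.
  by apply: integrable_sum => // i _; have [] := H i.
have mprod : measurable_fun D (fun t => \prod_(i < n) a i t).
  by apply: measurable_prod => i _; exact: ma.
have prod0 t : 0 <= \prod_(i < n) a i t by apply: prodr_ge0 => i _; exact: a0.
pose C := \prod_(i < n) K i.
have /integrableP[_ iCS] := integrableZl mD C iS.
apply/integrableP; split; first exact/measurable_EFinP.
apply: le_lt_trans iCS; rewrite integral_mkcond [leRHS]integral_mkcond.
have aeH : {ae mu, forall t, forall i, D t -> a i t <= K i * S t `^ s i}.
  apply: filter_forall => i; have [_ _ _ _] := H i.
  by apply: filterS => t aKs Dt; apply: aKs => //; exact: bS.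
apply: ge0_ae_le_integral => [t|t|].
- by rewrite /patch; case: ifP => //= _; rewrite abse_ge0.
- by rewrite /patch; case: ifP => //= _; rewrite abse_ge0.
- apply: filterS aeH => t aKs; rewrite /patch; case: ifPn => // /set_mem Dt.
  rewrite -EFinM /= lee_fin ger0_norm// (le_trans _ (ler_norm _))//.
  rewrite -[in leRHS](prodS t) /C -big_split/=.
  by apply: ler_prod => i _; rewrite a0 aKs.
Qed.

End Hoelder_integrable.

Section Lnorm_on_1.
Context {disp : measure_display} {T : measurableType disp} {R : realType}.
Variable mu : {measure set T -> \bar R}.
Implicit Types (D : set T) (f g h : T -> R).

Lemma Lnorm_on1E D f : Lnorm_on mu 1 D f = (\int[mu]_x (`|f \_ D x|%R)%:E)%E.
Proof.
rewrite /Lnorm_on Lnorm1; apply: eq_integral => x _.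
by rewrite /patch; case: ifP.
Qed.

Lemma Lnorm_on1_ae_eq D f g : {ae mu, forall x, D x -> f x = g x} ->
  Lnorm_on mu 1 D f = Lnorm_on mu 1 D g.
Proof.
move=> fg; rewrite !Lnorm_on1E; apply: ge0_ae_eq_integral_nonmeas => //.
by apply: filterS fg => x fg; rewrite /patch; case: ifPn => // /set_mem/fg ->.
Qed.

(** Additivity of the integral is applied to the measurable representatives of g and h; the function
    f enters only through an almost everywhere comparison. *)
Lemma Lnorm_on1_triangle D f g h : measurable D -> in_L1 mu D g ->
  in_L1 mu D h -> {ae mu, forall x, D x -> f x = g x + h x} ->
  (Lnorm_on mu 1 D f <= Lnorm_on mu 1 D g + Lnorm_on mu 1 D h)%E.
Proof.
move=> mD [g' ig' gg'] [h' ih' hh'] fgh.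
rewrite (Lnorm_on1_ae_eq gg') (Lnorm_on1_ae_eq hh') !Lnorm_on1E.
have mabs f' : mu.-integrable D (EFin \o f') ->
    measurable_fun setT (fun x => (`|f' \_ D x|%R)%:E).
  move=> /integrableP[/measurable_EFinP mf' _].
  apply/measurable_EFinP; apply: measurableT_comp => //.
  exact/(measurable_restrictT _ mD).
rewrite -ge0_integralD//; [|exact: mabs..].
apply: ge0_ae_le_integral => //; first by move=> x; rewrite adde_ge0.
apply: filterS3 fgh gg' hh' => x fgh gg' hh'.
rewrite -EFinD lee_fin /patch; case: ifPn => [/set_mem Dx|_].
  by rewrite fgh// gg'// hh'// ler_normD.
by rewrite !normr0 addr0.
Qed.

End Lnorm_on_1.

(** * Convergence for a fixed triple of fields *)

Section fixed_fields.
Context {R : realType} {d : nat}.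
Local Notation mu := (lebesgue_rV R d).
Variables (rho : 'rV[R]_d -> R) (O O' : set 'rV[R]_d) (l0 : R) (k : flux_kind).
Variable X : 'I_3 -> banach_field_space O'.
Variable C : R.
Hypotheses (hrho : mollification_kernel rho) (oO : open O) (oO' : open O')
  (OO' : O `<=` O') (l0_gt0 : 0 < l0).
Hypothesis OlO' : forall l, 0 < l < l0 ->
  forall x h, O x -> enorm h <= l -> O' (x + h).
Hypothesis flux_defined :
  forall l : R, 0 < l < l0 -> space_flux_defined k rho X O l.
Hypothesis flux_bound : forall v : (forall i, X i), forall l, 0 < l < l0 ->
  (Lnorm_on mu 1 O (space_flux k rho l v) <= (C * \prod_(i < 3) `|v i|)%:E)%E.
Hypothesis flux_smooth : forall v : (forall i, X i),
  (exists i0, smooth_elements (X i0) (v i0)) ->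
  Lnorm_on mu 1 O (space_flux k rho l v) @[l --> 0^'+] --> 0%E.
Hypothesis C_ge0 : 0 <= C.

Let mO : measurable O. Proof. exact: open_measurable_rV. Qed.
Let mO' : measurable O'. Proof. exact: open_measurable_rV. Qed.

Let E (v : forall i, X i) i := zero_ext O' (field_of (v i)).

Lemma measurable_field_zero_ext i (a : X i) :
  measurable_fun setT (zero_ext O' (field_of a)).
Proof. by apply: measurable_zero_ext => //; have [] := field_of_L1 a. Qed.

Lemma integrable_field_zero_ext i (a : X i) j :
  mu.-integrable setT (fun x => (zero_ext O' (field_of a) x ord0 j)%:E).
Proof. by apply: integrable_zero_ext => //; exact: field_of_L1. Qed.

Lemma space_flux_zero_ext l v x : 0 < l < l0 -> O x ->
  space_flux k rho l v x = global_flux k rho l (E v 0) (E v 1) (E v 2) x.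
Proof.
move=> ll0 Ox; have /andP[l_gt0 _] := ll0.
apply: (flux_zero_ext _ hrho l_gt0 oO OO' (OlO' ll0)) => // i.
exact: integrable_field_zero_ext.
Qed.

(** The representative of a + b is the sum of the representatives only almost everywhere. It is
    therefore first replaced by the exact sum [AB], and pointwise additivity is used where both
    fluxes are defined. *)
Lemma space_flux_additive l v i0 (a b : X i0) : 0 < l < l0 -> v i0 = a + b ->
  {ae mu, forall x, O x -> space_flux k rho l v x =
    space_flux k rho l (dfwith v i0 a) x +
    space_flux k rho l (dfwith v i0 b) x}.
Proof.
move=> ll0 vab; have /andP[l_gt0 _] := ll0.
pose A := zero_ext O' (field_of a); pose B := zero_ext O' (field_of b).
pose AB x := A x + B x; pose W Z i := if i == i0 then Z else E v i.
have Ea (c : X i0) i : E (dfwith v i0 c) i = W (zero_ext O' (field_of c)) i.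
  rewrite /E /W; have [->|ii0] := eqVneq i i0; first by rewrite dfwithin.
  by rewrite dfwithout// eq_sym.
have mAB : measurable_fun setT AB.
  by apply: measurable_fun_addrV; exact: measurable_field_zero_ext.
have mW i : measurable_fun setT (W AB i).
  by rewrite /W; case: ifP => // _; exact: measurable_field_zero_ext.
have EAB i : {ae mu, forall x, E v i x = W AB i x}.
  rewrite /W; have [->|_] := eqVneq i i0; last exact: aeW.
  have := field_of_linear 1 a b; apply: filterS => x.
  rewrite scale1r -vab /E /AB /A /B /zero_ext; case: ifPn => [/set_mem O'x|_ _].
    by move=> ->//; rewrite scale1r.
  by rewrite addr0.
have [dA _] := flux_defined ll0 (dfwith v i0 a).
have [dB _] := flux_defined ll0 (dfwith v i0 b).
have aeE := global_flux_ae_eq k hrho l_gt0 (measurable_field_zero_ext (v 0))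
  (measurable_field_zero_ext (v 1)) (measurable_field_zero_ext (v 2))
  (mW 0) (mW 1) (mW 2) (EAB 0) (EAB 1) (EAB 2).
apply: filterS3 dA dB aeE => x dA dB aeE Ox.
rewrite !space_flux_zero_ext// !Ea [LHS]aeE.
have zdef (c : X i0) : flux_defined_at k rho l (field_of (dfwith v i0 c 0))
      (field_of (dfwith v i0 c 1)) (field_of (dfwith v i0 c 2)) x ->
    global_flux_defined k rho l (W (zero_ext O' (field_of c)) 0)
      (W (zero_ext O' (field_of c)) 1) (W (zero_ext O' (field_of c)) 2) x.
  rewrite -!Ea => /(flux_defined_zero_ext hrho l_gt0 OO' (OlO' ll0) Ox).
  exact.
apply: (global_flux_additive hrho l_gt0).
- by move=> i; exact: integrable_field_zero_ext.
- by move=> i; exact: integrable_field_zero_ext.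
- exact: zdef (dA Ox).
- exact: zdef (dB Ox).
Qed.

Lemma cvg_space_flux (v : forall i, X i) :
  (exists i, dense (smooth_elements (X i))) ->
  Lnorm_on mu 1 O (space_flux k rho l v) @[l --> 0^'+] --> 0%E.
Proof.
move=> [i0 dense_i0]; apply: ge0_cvge0 => [l|e e0]; first exact: Lnorm_ge0.
pose P := C * \prod_(i < 3 | i != i0) `|v i|.
have P0 : 0 <= P by rewrite mulr_ge0// prodr_ge0.
(* Chosen so that delta * P <= e / 2; the summand 1 avoids dividing by 0 when P = 0. *)
pose delta := e / 2 / (P + 1).
have delta0 : 0 < delta by rewrite !divr_gt0// ltr_wpDl.
have [|a [va smooth_a]] := dense_i0 (ball (v i0) delta) _ (ball_open _ _).
  by exists (v i0); exact: ballxx.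
pose b : X i0 := v i0 - a.
have vab : v i0 = a + b by rewrite /b addrC subrK.
have sa : exists i, smooth_elements (X i) (dfwith v i0 a i).
  by exists i0; rewrite dfwithin.
have e2 : 0 < e / 2 by rewrite divr_gt0.
have fe : \forall l \near 0^'+,
    (Lnorm_on mu 1 O (space_flux k rho l (dfwith v i0 a)) <= (e / 2)%:E)%E.
  by apply: cvge0_near_le e2; exact: flux_smooth.
have ll : \forall l \near 0^'+, 0 < l < l0.
  near=> l; apply/andP; split; near: l; first exact: nbhs_right_gt.
  exact: nbhs_right_lt.
apply: filterS2 ll fe => l ll0 fa.
have [_ L1a] := flux_defined ll0 (dfwith v i0 a).
have [_ L1b] := flux_defined ll0 (dfwith v i0 b).
apply: le_trans (Lnorm_on1_triangle mO L1a L1b (space_flux_additive ll0 vab)) _.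
have -> : e%:E = ((e / 2)%:E + (e / 2)%:E)%E by rewrite -EFinD -splitr.
apply: leeD; first exact: fa.
apply: le_trans (flux_bound _ ll0) _; rewrite lee_fin (bigD1 i0)//= dfwithin.
rewrite (eq_bigr (fun i => `|v i|)); last first.
  by move=> i ii0; rewrite dfwithout// eq_sym.
rewrite mulrCA -/P.
have bd : `|b| <= delta by apply: ltW; move: va; rewrite -ball_normE.
apply: le_trans (ler_wpM2r P0 bd) _.
rewrite /delta mulrAC ler_pdivrMr ?ltr_wpDl// ler_wpM2l ?(ltW e2)//.
by rewrite lerDl.
Unshelve. all: by end_near. Qed.

End fixed_fields.

Section measurability_and_limits.
Context {R : realType}.

(** The norm of a simple function is measurable, its preimages being finite unions of fibres, and
    norms pass to the pointwise limit. *)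
Lemma strongly_measurable_norm {disp} {T : measurableType disp}
    (V : normedModType R) (D : set T) (f : T -> V) :
  strongly_measurable D f -> measurable_fun D (fun t => `|f t|).
Proof.
move=> [s ss sf]; apply: (measurable_fun_cvg (h := fun n t => `|s n t|)).
  move=> n mD Y mY; have [fin_s mfib] := ss n.
  rewrite (_ : _ `&` _ = \bigcup_(a in s n @` D `&` [set a | Y `|a|])
      (D `&` s n @^-1` [set a])); last first.
    apply/seteqP; split => t /=.
      by move=> [Dt Yt]; exists (s n t) => //; split => //; exists t.
    by move=> [a [_ Ya] [Dt sa]]; split=> //; rewrite (sa : s n t = a).
  by apply: fin_bigcup_measurable => [|a _]; [exact: finite_setIl|exact: mfib].
by move=> t Dt; apply: cvg_norm; exact: sf.
Qed.

Lemma ae_prod_snd {d1 d2} {T1 : measurableType d1} {T2 : measurableType d2}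
    (m1 : {sigma_finite_measure set T1 -> \bar R})
    (m2 : {sigma_finite_measure set T2 -> \bar R}) (P : set T2) :
  {ae m2, forall y, P y} -> {ae (m1 \x m2)%E, forall z, P z.2}.
Proof.
move=> [N [mN N0 NP]]; exists (setT `*` N); split.
- exact: measurableX.
- by rewrite product_measure1E// [X in (_ * X)%E]N0 mule0.
- by move=> z /= nP; split => //; exact: NP.
Qed.

Lemma ae_eq_integrable {disp} {T : measurableType disp}
    (mu : {measure set T -> \bar R}) (f g : T -> R) :
  measurable_fun setT f -> {ae mu, forall x, f x = g x} ->
  mu.-integrable setT (EFin \o g) -> mu.-integrable setT (EFin \o f).
Proof.
move=> mf fg /integrableP[_ gfin]; apply/integrableP; split.
  exact/measurable_EFinP.
apply: le_lt_trans gfin; apply: ge0_ae_le_integral => //.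
by apply: filterS fg => x /= ->.
Qed.

Lemma cvg_at_right_of_gt (u : R^nat) : (forall n, 0 < u n) ->
  u n @[n --> \oo] --> 0 -> u n @[n --> \oo] --> 0^'+.
Proof.
move=> u0 /cvgrPdist_lt cu P [e /= e0 eP]; apply: filterS (cu _ e0) => n un.
by apply: eP => //=.
Qed.

(** Dominated convergence concerns sequences, whence this sequential criterion. If the limit failed
    for some e, points l_n < 1/(n+1) violating the bound would form a contradicting sequence. *)
Lemma ge0_cvg_at_right0 (f : R -> \bar R) (l0 : R) : 0 < l0 ->
  (forall l, 0 <= f l)%E ->
  (forall u : R^nat, (forall n, 0 < u n < l0) -> u n @[n --> \oo] --> 0 ->
    f (u n) @[n --> \oo] --> 0%E) ->
  f l @[l --> 0^'+] --> 0%E.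
Proof.
move=> l00 f0 fu; apply: ge0_cvge0 => // e e0; apply: contrapT => nfe.
have /choice[u uP] (n : nat) : exists l : R, [/\ 0 < l, l < l0,
    l < n.+1%:R^-1 & ~ (f l <= e%:E)%E].
  apply: contrapT => /forallNP nl; apply: nfe.
  have lP : \forall l \near 0^'+, [/\ 0 < l, l < l0 & l < n.+1%:R^-1].
    near=> l; split; near: l; first exact: nbhs_right_gt.
    - exact: nbhs_right_lt.
    - by apply: nbhs_right_lt; rewrite invr_gt0.
  apply: filterS lP => l [lgt0 ll0 ln]; apply: contrapT => fl.
  by apply: (nl l).
have u0 : u n @[n --> \oo] --> 0.
  apply: (@squeeze_cvgr _ _ _ _ (fun=> 0) (fun n => n.+1%:R^-1)).
  - by apply: nearW => n; have [u0 _ un _] := uP n; rewrite !ltW.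
  - exact: cvg_cst.
  - exact: cvg_harmonic.
have ul0 n : 0 < u n < l0 by have [-> -> _ _] := uP n.
have := cvge0_near_le (fu u ul0 u0) e0.
by move=> [n _ /(_ n (leqnn n))]; have [_ _ _] := uP n.
Unshelve. all: by end_near. Qed.

End measurability_and_limits.

(** * The space-time flux: Tonelli and dominated convergence in time *)

Theorem theorem1p2 (R : realType) (d : nat)
    (rho : 'rV[R]_d -> R) (hrho : mollification_kernel rho)
    (Omega O O' : set 'rV[R]_d) (T : R) (J : set R) (l0 : R)
    (Omega_open : open Omega) (T_gt0 : 0 < T)
    (O_open : open O) (O'_open : open O')
    (O_O' : compactly_contained O O')
    (O'_Omega : compactly_contained O' Omega)
    (J_open : open J) (J_itv : is_interval J) (J_T : J `<=` `]0, T[)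
    (l0_gt0 : 0 < l0) (l0_dist : (l0%:E < set_dist O (boundary O'))%E)
    (u : 'rV[R]_d * measurableTypeR R -> 'rV[R]_d)
    (u_L3 : in_Lp_vec (spacetime_measure R d) 3%:E (O' `*` J) u)
    (k : flux_kind)
    (X : 'I_3 -> banach_field_space O')
    (flux_defined : forall l : R, 0 < l < l0 -> space_flux_defined k rho X O l)
    (C : R) (C_gt0 : 0 < C)
    (flux_bound : forall v : (forall i, X i),
      (ereal_sup [set Lnorm_on (lebesgue_rV R d) 1 O (space_flux k rho l v)
        | l in [set l : R | (0 < l < l0)%R]]
       <= (C * \prod_(i < 3) `|v i|)%:E)%E)
    (flux_smooth : forall v : (forall i, X i),
      (exists i0, smooth_elements (X i0) (v i0)) ->
      Lnorm_on (lebesgue_rV R d) 1%E O (space_flux k rho l v)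
        @[l --> 0^'+] --> 0%E)
    (p : 'I_3 -> \bar R) (p_ge1 : forall i, (1 <= p i)%E)
    (p_sum : (\sum_(i < 3) (p i)^-1 = 1)%E)
    (u_X : forall i, in_Lp_field (X i) (p i) J u)
    (X_dense : exists i, dense (smooth_elements (X i))) :
  let D (l : R) (z : 'rV[R]_d * measurableTypeR R) :=
    let v x := u (x, z.2) in flux k rho l v v v z.1 in
  (forall l : R, 0 < l < l0 -> in_L1 (spacetime_measure R d) (O `*` J) (D l)) /\
  Lnorm_on (spacetime_measure R d) 1%E (O `*` J) (D l) @[l --> 0^'+] --> 0%E.
Proof.
have OO' : O `<=` O' by move=> x Ox; apply: O_O'.2; exact: subset_closure.
have OlO' l : 0 < l < l0 -> forall x h, O x -> enorm h <= l -> O' (x + h).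
  move=> /andP[_ ll0] x h Ox hl.
  apply: (add_in_of_set_dist O'_open Ox (OO' _ Ox) _ hl).
  by apply: lt_trans l0_dist; rewrite lte_fin.
have mO : measurable O by exact: open_measurable_rV.
have mO' : measurable O' by exact: open_measurable_rV.
have mJ : measurable (J : set (measurableTypeR R)) by exact: open_measurable.
have bound (v : forall i, X i) l : 0 < l < l0 ->
    (Lnorm_on (lebesgue_rV R d) 1 O (space_flux k rho l v)
      <= (C * \prod_(i < 3) `|v i|)%:E)%E.
  move=> ll0; apply: le_trans (flux_bound v).
  by apply: ereal_sup_ubound; exists l.
have [f Hf] : exists f : forall i, R -> X i, forall i,
    in_Lp_Bochner lebesgue_measure (p i) J (f i) /\
    {ae lebesgue_measure, forall t, J t -> {ae lebesgue_rV R d, forall x,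
      O' x -> field_of (f i t) x = u (x, t)}}.
  exists (fun i => sval (cid2 (u_X i))) => i.
  by case: cid2.
(* Extension by zero in space and time, hence measurable on all of space-time; the flux [g] computed
   from it is jointly measurable. *)
pose uJ := zero_ext (O' `*` J) u.
have muJ : measurable_fun setT uJ.
  by apply: measurable_zero_ext; [exact: measurableX|exact: u_L3.1].
have muJt t : measurable_fun setT (fun x => uJ (x, t)).
  exact: (measurableT_comp muJ (pair2_measurable t)).
move=> D.
pose g l (z : 'rV[R]_d * measurableTypeR R) :=
  let v x := uJ (x, z.2) in global_flux k rho l v v v z.1.
have mg l : measurable_fun setT (g l).
  exact: (measurable_global_flux_param k l hrho muJ).
have uJE t : J t -> (fun x => uJ (x, t)) = zero_ext O' (fun x => u (x, t)).
  move=> Jt; apply/funext => x; rewrite /uJ /zero_ext;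
      congr (if _ then _ else _).
  by apply/idP/idP; rewrite !inE /=; tauto.
(* The times at which all three Bochner representatives agree with the slice of u; almost every time
   is good. *)
pose good t := J t -> forall i, {ae lebesgue_rV R d, forall x,
  zero_ext O' (field_of (f i t)) x = uJ (x, t)}.
have FL : Filter (nbhs (almost_everywhere (@lebesgue_measure R))).
  exact: ae_filter_ringOfSetsType.
have ae_good : {ae lebesgue_measure, forall t, good t}.
  have : {ae lebesgue_measure, forall t, forall i, J t -> {ae lebesgue_rV R d,
      forall x, O' x -> field_of (f i t) x = u (x, t)}}.
    by apply: filter_forall => i; have [] := Hf i.
  apply: filterS => t ft Jt i; apply: filterS (ft i Jt) => x fx.
  by rewrite (congr1 (@^~ x) (uJE _ Jt)) /zero_ext;
      case: ifPn => // /set_mem/fx.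
have intuJ t i : good t -> J t ->
    (lebesgue_rV R d).-integrable setT (fun x => (uJ (x, t) ord0 i)%:E).
  move=> gt Jt.
  (* The slice inherits integrability from the inclusion of X_i in L^1(O'); the choice of the first
     space is arbitrary. *)
  apply: (@ae_eq_integrable _ _ _ _ _
    (fun x => zero_ext O' (field_of (f ord0 t)) x ord0 i)).
  - exact: measurable_fun_coord.
  - by apply: filterS (gt Jt ord0) => x ->.
  - exact: integrable_field_zero_ext.
have gD l t x : 0 < l < l0 -> good t -> J t -> O x -> D l (x, t) = g l (x, t).
  move=> ll0 gt Jt Ox; have /andP[l_gt0 _] := ll0.
  rewrite /D /g /= (flux_zero_ext _ hrho l_gt0 O_open OO' (OlO' _ ll0))//.
    by rewrite -!uJE.
  by move=> i; rewrite -uJE//; exact: intuJ.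
(* Here the single slice of u is exchanged for three possibly different representatives, one in each
   X_i, to which the bound and the convergence apply. *)
have gN l t : 0 < l < l0 -> good t -> J t ->
    Lnorm_on (lebesgue_rV R d) 1 O (fun x => g l (x, t)) =
    Lnorm_on (lebesgue_rV R d) 1 O (space_flux k rho l (fun i => f i t)).
  move=> ll0 gt Jt; have /andP[l_gt0 _] := ll0; apply: Lnorm_on1_ae_eq.
  have mf i := measurable_field_zero_ext O'_open (f i t).
  have := global_flux_ae_eq k hrho l_gt0 (mf 0) (mf 1) (mf 2)
    (muJt t) (muJt t) (muJt t) (gt Jt 0) (gt Jt 1) (gt Jt 2).
  apply: filterS => x gx Ox.
  by rewrite (space_flux_zero_ext k hrho O_open O'_open OO' OlO' _ ll0 Ox) gx.
pose h l (z : 'rV[R]_d * measurableTypeR R) : \bar R :=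
  (`|g l \_ (O `*` J) z|%R)%:E.
have h0 l z : (0 <= h l z)%E by rewrite lee_fin.
have mh l : measurable_fun setT (h l).
  apply/measurable_EFinP; apply: measurableT_comp => //.
  by apply/(measurable_restrictT _ (measurableX mO mJ));
      exact: measurable_funTS.
(* At a good time in J this is the L^1(O) norm of the flux, and off J it is 0; by Tonelli its time
   integral is the space-time norm of [g l]. *)
pose H l (t : measurableTypeR R) : \bar R :=
  (\int[lebesgue_rV R d]_x h l (x, t))%E.
have mH l : measurable_fun setT (H l).
  exact: (@measurable_fun_fubini_tonelli_G _ _ _ _ _ (lebesgue_rV R d) (h l)
      (mh l) (h0 l)).
have HJ l t : 0 < l < l0 -> good t -> J t -> H l t =
    Lnorm_on (lebesgue_rV R d) 1 O (space_flux k rho l (fun i => f i t)).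
  move=> ll0 gt Jt; rewrite -gN// Lnorm_on1E; apply: eq_integral => x _.
  rewrite /h /patch; congr (`| if _ then _ else _ |%:E).
  by apply/idP/idP; rewrite !inE /=; tauto.
have HnJ l t : ~ J t -> H l t = 0%E.
  move=> Jt; apply: integral0_eq => x _; rewrite /h /patch ifF ?normr0//.
  by apply/negP; rewrite inE => -[].
pose G t := C * \prod_(i < 3) `|f i t|.
have iG : (@lebesgue_measure R).-integrable J (EFin \o G).
  apply: (@integrableZl _ _ _ _ _ mJ C (fun t => (\prod_(i < 3) `|f i t|)%:E)).
  apply: (integrable_prod mJ (p := p)) => // i; have [[sf Lf] _] := Hf i.
    exact: strongly_measurable_norm.
  exact: Lf.
have iGJ : (@lebesgue_measure R).-integrable setT ((EFin \o G) \_ J).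
  by rewrite -integrable_mkcond.
have HG l : 0 < l < l0 -> {ae lebesgue_measure, forall t,
    (`|H l t| <= ((EFin \o G) \_ J) t)%E}.
  move=> ll0; apply: filterS ae_good => t gt.
  rewrite gee0_abs; last by apply: integral_ge0 => x _; exact: h0.
  rewrite /patch; case: ifPn => [/set_mem Jt|/negP];
      first by rewrite HJ// bound.
  by rewrite inE => nJt; rewrite HnJ.
have LgH l : Lnorm_on (spacetime_measure R d) 1 (O `*` J) (g l) =
    (\int[lebesgue_measure]_t H l t)%E.
  rewrite Lnorm_on1E.
  exact: (fubini_tonelli2 (h l) (mh l) (h0 l)).
(* [D l] itself need not be measurable; it is handled through its measurable version [g l]. *)
have LDg l : 0 < l < l0 ->
    {ae spacetime_measure R d, forall z, (O `*` J) z -> D l z = g l z}.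
  move=> ll0; have := ae_prod_snd (lebesgue_rV R d) ae_good.
  by apply: filterS => -[x t] /= gt [Ox Jt]; exact: gD.
have intH l : 0 < l < l0 -> (\int[lebesgue_measure]_t H l t < +oo)%E.
  move=> ll0; have /integrableP[_] := iGJ; apply: le_lt_trans.
  apply: ge0_ae_le_integral => [t|t|].
  - by apply: integral_ge0 => x _; exact: h0.
  - exact: abse_ge0.
  - apply: filterS (HG _ ll0) => t Ht.
    by apply: le_trans (lee_abs _) _; apply: le_trans Ht (lee_abs _).
split=> [l ll0|].
  exists (g l); last exact: LDg.
  apply/integrableP; split.
    by apply/measurable_EFinP; exact: measurable_funTS.
  apply: le_lt_trans (intH _ ll0); rewrite -LgH Lnorm_on1E integral_mkcond.
  apply: ge0_ae_le_integral => // [z|].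
    by rewrite /patch; case: ifP.
  by apply: aeW => z; rewrite /patch; case: ifP => // _; rewrite normr0.
apply: (ge0_cvg_at_right0 l0_gt0) => [l|v vl0 v0]; first exact: Lnorm_ge0.
under eq_fun do rewrite (Lnorm_on1_ae_eq (LDg _ (vl0 _))) LgH.
have := @dominated_convergence _ _ _ (@lebesgue_measure R) _ measurableT
  (fun n => H (v n)) (cst 0%E) ((EFin \o G) \_ J).
case=> //.
(* Pointwise convergence: off J the sequence is constantly 0, and at a good time in J it is the
   result for fixed fields along v_n -> 0+. *)
- apply: filterS ae_good => t gt _.
  have [Jt|nJt] := pselect (J t); last first.
    by under eq_fun do rewrite HnJ//; exact: cvg_cst.
  under eq_fun do rewrite HJ//.
  have := cvg_space_flux hrho O_open O'_open OO' l0_gt0 OlO' flux_defined bound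
    flux_smooth (ltW C_gt0) (fun i => f i t) X_dense.
  apply: cvg_comp; apply: cvg_at_right_of_gt => // n.
  by have /andP[] := vl0 n.
- have : {ae lebesgue_measure, forall t, forall n,
      (`|H (v n) t| <= ((EFin \o G) \_ J) t)%E}.
    by apply/ae_foralln => n; exact: HG.
  by apply: filterS => t Ht n _.
by move=> _ _; rewrite integral0.
Qed.
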